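(* Let $R$ be a commutative noetherian ring, let $M$ be a finitely generated $R$-module, and let $n\ge 0$ be an integer. If the $n$th syzygy $\Omega^n M$ is $(n+1)$-torsionfree, then $M$ can be embedded in a finitely generated $R$-module of projective dimension at most $n$. The converse is also true if $M_{\mathfrak p}$ has finite Gorenstein dimension over $R_{\mathfrak p}$ for all prime ideals $\mathfrak p$ of $R$ with $\operatorname{depth} R_{\mathfrak p}<n$.
   Context: All rings are commutative noetherian and all modules are finitely generated. Write $(-)^\ast=\operatorname{Hom}_R(-,R)$. Syzygy and transpose: for a projective presentation $P_1\xrightarrow{\partial}P_0\to M\to 0$ (with $P_0,P_1$ finitely generated projective), the (first) syzygy is $\Omega M=\operatorname{Im}\partial$ and the (Auslander) transpose is $\operatorname{Tr}M=\operatorname{Coker}(\partial^\ast:P_0^\ast\to P_1^\ast)$. These are uniquely determined by $M$ up to projective summands. Put $\Omega^0M=M$ and $\Omega^nM=\Omega(\Omega^{n-1}M)$ for $n>0$. $n$-torsionfree: for an integer $n\ge 0$, an $R$-module $M$ is $n$-torsionfree if $\operatorname{Ext}^i_R(\operatorname{Tr}M,R)=0$ for all integers $1\le i\le n$. Gorenstein dimension: an $R$-module $G$ is Gorenstein projective if $\operatorname{Ext}^i_R(G,R)=0$ and $\operatorname{Ext}^i_R(\operatorname{Tr}G,R)=0$ for all $i>0$. The Gorenstein dimension of $M$ is the infimum of the integers $n$ for which there is an exact sequence $0\to G_n\to\cdots\to G_1\to G_0\to M\to 0$ with each $G_i$ Gorenstein projective. ''$M$ can be embedded in $W$'' means that there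 is an injective $R$-homomorphism $M\to W$. *)

(* Defs.v *)
From HB Require Import structures.
From mathcomp Require Import all_boot all_algebra.
From mathcomp Require Import ring_quotient generic_quotient.
From mathcomp Require Import boolp ring.

Set Implicit Arguments.
Unset Strict Implicit.
Unset Printing Implicit Defensive.

Import GRing.Theory.
Local Open Scope ring_scope.
Local Open Scope quotient_scope.

(* Rings are comPzRingType, not comNzRingType, so that the zero ring is allowed. *)

Section FiniteGeneration.
Variable R : comPzRingType.

Definition in_span (M : lmodType R) (s : seq M) (x : M) : Prop :=
  exists a : nat -> R, x = \sum_(i < size s) a i *: s`_i.

Definition fin_gen (M : lmodType R) : Prop :=
  exists s : seq M, forall x, in_span s x.

Definition is_submodule (M : lmodType R) (N : M -> Prop) : Prop :=
  [/\ N 0, (forall x y, N x -> N y -> N (x + y))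
    & (forall (a : R) x, N x -> N (a *: x))].

Definition noetherian : Prop :=
  forall I : R^o -> Prop, is_submodule I ->
    exists s : seq R^o, forall x, I x <-> in_span s x.

End FiniteGeneration.

Section ImageCokernel.
Variables (R : comPzRingType) (U V : lmodType R) (f : {linear U -> V}).

Definition in_image : {pred V} := fun v => `[< exists u, f u = v >].

Lemma in_image_subsemimod : subsemimod_closed in_image.
Proof.
split; first split.
- by apply/asboolP; exists 0; rewrite linear0.
- move=> x y /asboolP[u <-] /asboolP[v <-].
  by apply/asboolP; exists (u + v); rewrite linearD.
- move=> a x /asboolP[u <-].
  by apply/asboolP; exists (a *: u); rewrite linearZ.
Qed.

HB.instance Definition _ :=
  GRing.isSubmodClosed.Build R V in_image in_image_subsemimod.

Definition image_module : Type := {v : V | v \in in_image}.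
HB.instance Definition _ := SubChoice.on image_module.
HB.instance Definition _ := [SubChoice_isSubLmodule of image_module by <:].

Definition coker : Type := Quotient.quot in_image.
HB.instance Definition _ := GRing.Zmodule.on coker.

Definition coker_scale (a : R) (x : coker) : coker :=
  \pi_(Quotient.quot in_image) (a *: repr x).

Local Notation cpi := (\pi_(Quotient.quot in_image)).

Lemma coker_piZ a v : coker_scale a (cpi v) = cpi (a *: v).
Proof.
apply/eqP; rewrite /coker_scale -Quotient.idealrBE -scalerBr.
by apply: rpredZ; rewrite Quotient.idealrBE reprK.
Qed.

Lemma coker_piW (P : coker -> Prop) : (forall v, P (cpi v)) -> forall x, P x.
Proof. exact: quotW. Qed.

Lemma coker_piD u v : cpi u + cpi v = cpi (u + v) :> coker.
Proof. by rewrite Quotient.pi_add. Qed.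

Fact coker_scaleA a b x :
  coker_scale a (coker_scale b x) = coker_scale (a * b) x.
Proof. by elim/coker_piW: x => x; rewrite !coker_piZ scalerA. Qed.

Fact coker_scale1 : left_id 1 coker_scale.
Proof. by elim/coker_piW => x; rewrite coker_piZ scale1r. Qed.

Fact coker_scaleDr : right_distributive coker_scale +%R.
Proof.
move=> a; elim/coker_piW => x; elim/coker_piW => y.
by rewrite coker_piD !coker_piZ coker_piD scalerDr.
Qed.

Fact coker_scaleDl x : {morph coker_scale^~ x : a b / a + b}.
Proof.
by elim/coker_piW: x => x a b; rewrite !coker_piZ coker_piD scalerDl.
Qed.

HB.instance Definition _ := GRing.Zmodule_isLmodule.Build R coker
  coker_scaleA coker_scale1 coker_scaleDr coker_scaleDl.

End ImageCokernel.

Section Dual.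
Variable R : comPzRingType.

Definition dual (M : lmodType R) : Type := {linear M -> R^o}.

Section DualModule.
Variable M : lmodType R.

Definition dual_fun (f : dual M) : M -> R := (f : {linear M -> R^o}).

Lemma dual_ext (f g : dual M) : dual_fun f =1 dual_fun g -> f = g.
Proof.
case: f g => [f cf] [g cg] fg; have {}fg : f = g by apply: funext.
case: _ / fg cg => cg; congr GRing.Linear.Pack.
case: cf cg => [[a] [b]] [[a'] [b']].
by rewrite (Prop_irrelevance a a') (Prop_irrelevance b b').
Qed.

HB.instance Definition _ := gen_eqMixin (dual M).
HB.instance Definition _ := gen_choiceMixin (dual M).

Fact dual_zero_linear : linear ((fun=> 0) : M -> R^o).
Proof. by move=> a x y; rewrite scaler0 addr0. Qed.
Fact dual_opp_linear (f : {linear M -> R^o}) :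
  linear ((fun x => - f x) : M -> R^o).
Proof. by move=> a x y; rewrite linearP opprD scalerN. Qed.
Fact dual_add_linear (f g : {linear M -> R^o}) :
  linear ((fun x => f x + g x) : M -> R^o).
Proof. by move=> a x y; rewrite !linearP scalerDr addrACA. Qed.
Fact dual_scale_linear (c : R) (f : {linear M -> R^o}) :
  linear ((fun x => c *: f x) : M -> R^o).
Proof. by move=> a x y; rewrite linearP scalerDr !scalerA mulrC. Qed.

Definition linear_pack (f : M -> R^o) (fl : linear f) : {linear M -> R^o} :=
  HB.pack f (GRing.isLinear.Build R M R^o *:%R f fl).

Definition dual_zero : dual M := linear_pack dual_zero_linear.
Definition dual_opp (f : dual M) : dual M := linear_pack (dual_opp_linear f).
Definition dual_add (f g : dual M) : dual M :=
  linear_pack (dual_add_linear f g).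
Definition dual_scale (c : R) (f : dual M) : dual M :=
  linear_pack (dual_scale_linear c f).

Fact dual_addA : associative dual_add.
Proof. by move=> f g h; apply: dual_ext => x; apply: addrA. Qed.
Fact dual_addC : commutative dual_add.
Proof. by move=> f g; apply: dual_ext => x; apply: addrC. Qed.
Fact dual_add0 : left_id dual_zero dual_add.
Proof. by move=> f; apply: dual_ext => x; apply: add0r. Qed.
Fact dual_addN : left_inverse dual_zero dual_opp dual_add.
Proof. by move=> f; apply: dual_ext => x; apply: addNr. Qed.

HB.instance Definition _ :=
  GRing.isZmodule.Build (dual M) dual_addA dual_addC dual_add0 dual_addN.

Fact dual_scaleA a b f : dual_scale a (dual_scale b f) = dual_scale (a * b) f.
Proof. by apply: dual_ext => x; apply: mulrA. Qed.
Fact dual_scale1 : left_id 1 dual_scale.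
Proof. by move=> f; apply: dual_ext => x; apply: mul1r. Qed.
Fact dual_scaleDr : right_distributive dual_scale +%R.
Proof. by move=> a f g; apply: dual_ext => x; apply: mulrDr. Qed.
Fact dual_scaleDl f : {morph dual_scale^~ f : a b / a + b}.
Proof. by move=> a b; apply: dual_ext => x; apply: mulrDl. Qed.

HB.instance Definition _ := GRing.Zmodule_isLmodule.Build R (dual M)
  dual_scaleA dual_scale1 dual_scaleDr dual_scaleDl.

End DualModule.

Section DualMap.
Variables (U V : lmodType R) (f : {linear U -> V}).

Definition dual_map (h : dual V) : dual U :=
  (h : {linear V -> R^o}) \o f : {linear U -> R^o}.

Fact dual_map_linear : linear dual_map.
Proof. by move=> a g h; apply: dual_ext. Qed.

HB.instance Definition _ :=
  GRing.isLinear.Build R (dual V) (dual U) *:%R dual_map dual_map_linear.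

End DualMap.
End Dual.

Section HomologicalAlgebra.
Variable R : comPzRingType.

Definition surjective (U V : lmodType R) (f : {linear U -> V}) : Prop :=
  forall v, exists u, f u = v.

Definition exact (U V W : lmodType R)
    (f : {linear U -> V}) (g : {linear V -> W}) : Prop :=
  forall v, g v = 0 <-> exists u, f u = v.

Definition projective (P : lmodType R) : Prop :=
  forall (A B : lmodType R) (g : {linear A -> B}) (f : {linear P -> B}),
    surjective g -> exists h : {linear P -> A}, forall x, g (h x) = f x.

Definition fg_projective (P : lmodType R) : Prop := fin_gen P /\ projective P.

Record presentation (M : lmodType R) := Presentation {
  pres1 : lmodType R;
  pres0 : lmodType R;
  pres_map : {linear pres1 -> pres0};
  pres_aug : {linear pres0 -> M};
  pres1_proj : fg_projective pres1;
  pres0_proj : fg_projective pres0;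
  pres_exact : exact pres_map pres_aug;
  pres_surj : surjective pres_aug }.

Definition syzygy (M : lmodType R) (P : presentation M) : lmodType R :=
  image_module (pres_map P).

Definition transpose (M : lmodType R) (P : presentation M) : lmodType R :=
  coker (dual_map (pres_map P)).

(* [is_syzygy M n N]: N is an n-th syzygy of M, for some choice of the
   presentations used in the successive steps. *)
Inductive is_syzygy (M : lmodType R) : nat -> lmodType R -> Prop :=
  | IsSyzygy0 : is_syzygy M 0 M
  | IsSyzygyS n N (P : presentation N) :
      is_syzygy M n N -> is_syzygy M n.+1 (syzygy P).

(* Left resolutions ... -> F 1 -> F 0 -> M -> 0 by modules in the class C; those
   of length at most n are the ones with F i = 0 for i > n. *)
Record resolution (C : lmodType R -> Prop) (M : lmodType R) := Resolution {
  res :> nat -> lmodType R;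
  res_map : forall i, {linear res i.+1 -> res i};
  res_aug : {linear res 0 -> M};
  res_class : forall i, C (res i);
  res_surj : surjective res_aug;
  res_exact0 : exact (res_map 0) res_aug;
  res_exactS : forall i, exact (res_map i.+1) (res_map i) }.

Definition length_le (C : lmodType R -> Prop) (M : lmodType R)
    (F : resolution C M) (n : nat) : Prop :=
  forall i, (n < i)%N -> forall x : F i, x = 0.

Definition proj_dim_le (M : lmodType R) (n : nat) : Prop :=
  exists F : resolution fg_projective M, length_le F n.

Definition cocycle (C : lmodType R -> Prop) (M : lmodType R)
    (F : resolution C M) (i : nat) (f : dual (F i)) : Prop :=
  dual_map (res_map F i) f = 0.

Definition coboundary (C : lmodType R -> Prop) (M : lmodType R)
    (F : resolution C M) (i : nat) : dual (F i) -> Prop :=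
  match i with
  | 0 => fun f => f = 0
  | j.+1 => fun f => exists g : dual (F j), f = dual_map (res_map F j) g
  end.

(* Ext^i_R(M, R) = 0: the complex Hom_R(F, R) is exact in degree i for every
   resolution F of M by finitely generated projectives. Whether it is exact does
   not depend on F, and over a noetherian ring every finitely generated M has
   such an F; the same holds for the presentations quantified over below. *)
Definition Ext_vanishes (i : nat) (M : lmodType R) : Prop :=
  forall (F : resolution fg_projective M) (f : dual (F i)),
    cocycle f -> coboundary f.

Definition torsionfree (n : nat) (M : lmodType R) : Prop :=
  forall (P : presentation M) (i : nat),
    (1 <= i <= n)%N -> Ext_vanishes i (transpose P).

Definition gorenstein_projective (G : lmodType R) : Prop :=
  [/\ fin_gen G,
      (forall i, (0 < i)%N -> Ext_vanishes i G)
    & (forall (P : presentation G) (i : nat),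
         (0 < i)%N -> Ext_vanishes i (transpose P))].

Definition finite_gorenstein_dim (M : lmodType R) : Prop :=
  exists (n : nat) (F : resolution gorenstein_projective M), length_le F n.

End HomologicalAlgebra.

Record prime_ideal (R : comPzRingType) := PrimeIdeal {
  prime_set :> R -> Prop;
  prime_submodule : @is_submodule R R^o prime_set;
  prime_proper : ~ prime_set 1;
  prime_mul : forall a b, prime_set (a * b) -> prime_set a \/ prime_set b }.

Section Localization.
Variables (R : comPzRingType) (p : prime_ideal R).

Definition is_denom : {pred R} := fun s => `[< ~ p s >].
Definition denom : Type := {s : R | s \in is_denom}.
HB.instance Definition _ := SubChoice.on denom.

Fact denom1_subproof : 1 \in is_denom.
Proof. by apply/asboolP; apply: prime_proper. Qed.
Definition denom1 : denom := Sub 1 denom1_subproof.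

Definition dval (s : denom) : R := sval s.

Fact denomM_subproof (s t : denom) : dval s * dval t \in is_denom.
Proof.
apply/asboolP => /prime_mul[]; first by have /asboolP := valP s.
by have /asboolP := valP t.
Qed.
Definition denomM (s t : denom) : denom := Sub (dval s * dval t) (denomM_subproof s t).

Lemma dval1 : dval denom1 = 1. Proof. by []. Qed.
Lemma dvalM s t : dval (denomM s t) = dval s * dval t. Proof. by []. Qed.
Let dvalE := (dval1, dvalM).

Section Module.
Variable M : lmodType R.

(* x.1 / x.2 = y.1 / y.2 *)
Definition frac_rel (x y : M * denom) : bool :=
  `[< exists u : denom,
        (dval u * dval y.2) *: x.1 = (dval u * dval x.2) *: y.1 >].

Fact frac_rel_refl : reflexive frac_rel.
Proof. by move=> x; apply/asboolP; exists denom1. Qed.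
Fact frac_rel_sym : symmetric frac_rel.
Proof. by move=> x y; apply/asboolP/asboolP => -[u uE]; exists u. Qed.
Fact frac_rel_trans : transitive frac_rel.
Proof.
move=> y x z /asboolP[u uE] /asboolP[v vE]; apply/asboolP.
exists (denomM (denomM u v) y.2); rewrite ?dvalE /=.
transitivity ((dval v * dval z.2) *: ((dval u * dval y.2) *: x.1)).
  by rewrite scalerA; congr (_ *: _); ring.
rewrite uE scalerA.
transitivity ((dval u * dval x.2) *: ((dval v * dval z.2) *: y.1)).
  by rewrite scalerA; congr (_ *: _); ring.
by rewrite vE scalerA; congr (_ *: _); ring.
Qed.

Canonical frac_equiv := EquivRel frac_rel frac_rel_refl frac_rel_sym frac_rel_trans.
Canonical frac_encModRel := defaultEncModRel frac_rel.

Definition localize : Type := {eq_quot frac_rel}.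
HB.instance Definition _ := Choice.on localize.

Definition lfrac (m : M) (s : denom) : localize := \pi_({eq_quot frac_rel}) (m, s).

Lemma fracP m s n t :
  lfrac m s = lfrac n t <->
  exists u : denom, (dval u * dval t) *: m = (dval u * dval s) *: n.
Proof.
split; last by move=> h; apply/eqmodP/asboolP.
by move=> /eqmodP/asboolP.
Qed.

Lemma frac_eq m s n t : dval t *: m = dval s *: n -> lfrac m s = lfrac n t.
Proof. by move=> h; apply/fracP; exists denom1; rewrite ?dvalE !mul1r. Qed.

Lemma fracW (P : localize -> Prop) :
  (forall m s, P (lfrac m s)) -> forall x, P x.
Proof. by move=> h; apply: quotW => -[m s]; apply: h. Qed.

Definition numer_of (x : localize) : M * denom := repr x.

Lemma numer_ofK x : lfrac (numer_of x).1 (numer_of x).2 = x.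
Proof. by rewrite /lfrac -surjective_pairing; apply: reprK. Qed.

Definition loc_zero : localize := lfrac 0 denom1.
Definition loc_opp (x : localize) : localize :=
  lfrac (- (numer_of x).1) (numer_of x).2.
Definition loc_add (x y : localize) : localize :=
  let: (m, s) := numer_of x in let: (n, t) := numer_of y in
  lfrac (dval t *: m + dval s *: n) (denomM s t).

Lemma loc_oppE m s : loc_opp (lfrac m s) = lfrac (- m) s.
Proof.
rewrite /loc_opp; have := numer_ofK (lfrac m s).
case: (numer_of _) => n t /fracP[u uE]; apply/fracP; exists u => /=.
by rewrite !scalerN uE.
Qed.

Lemma loc_addE m s n t :
  loc_add (lfrac m s) (lfrac n t) = lfrac (dval t *: m + dval s *: n) (denomM s t).
Proof.
rewrite /loc_add; have := numer_ofK (lfrac m s); have := numer_ofK (lfrac n t).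
case: (numer_of _) => n' t' /fracP[v vE].
case: (numer_of _) => m' s' /fracP[u uE]; apply/fracP.
exists (denomM u v); rewrite ?dvalE /= in uE vE *.
rewrite ?dvalE !scalerDr !scalerA; congr (_ + _).
  transitivity ((dval v * dval t * dval t') *: ((dval u * dval s) *: m')).
    by rewrite scalerA; congr (_ *: _); ring.
  by rewrite uE scalerA; congr (_ *: _); ring.
transitivity ((dval u * dval s * dval s') *: ((dval v * dval t) *: n')).
  by rewrite scalerA; congr (_ *: _); ring.
by rewrite vE scalerA; congr (_ *: _); ring.
Qed.

Fact loc_addA : associative loc_add.
Proof.
elim/fracW => a s; elim/fracW => b t; elim/fracW => c u.
rewrite !loc_addE; apply: frac_eq; rewrite ?dvalE /= !scalerDr !scalerA !addrA.
by congr (_ + _ + _); congr (_ *: _); ring.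
Qed.

Fact loc_addC : commutative loc_add.
Proof.
elim/fracW => a s; elim/fracW => b t; rewrite !loc_addE; apply: frac_eq.
by rewrite ?dvalE /= addrC mulrC.
Qed.

Fact loc_add0 : left_id loc_zero loc_add.
Proof.
elim/fracW => a s; rewrite loc_addE; apply: frac_eq.
by rewrite ?dvalE /= scaler0 add0r scale1r mul1r.
Qed.

Fact loc_addN : left_inverse loc_zero loc_opp loc_add.
Proof.
elim/fracW => a s; rewrite loc_oppE loc_addE; apply: frac_eq.
by rewrite ?dvalE /= scalerN addNr !scaler0.
Qed.

HB.instance Definition _ :=
  GRing.isZmodule.Build localize loc_addA loc_addC loc_add0 loc_addN.

Lemma fracD m s n t :
  lfrac m s + lfrac n t = lfrac (dval t *: m + dval s *: n) (denomM s t).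
Proof. exact: loc_addE. Qed.

End Module.

Definition loc_scale (M : lmodType R)
    (a : localize R^o) (x : localize M) : localize M :=
  let: (r, s) := numer_of a in let: (m, t) := numer_of x in
  lfrac (r *: m) (denomM s t).

Lemma loc_scaleE (M : lmodType R) (r : R^o) s (m : M) t :
  loc_scale (lfrac r s) (lfrac m t) = lfrac (r *: m) (denomM s t).
Proof.
rewrite /loc_scale; have := numer_ofK (lfrac r s); have := numer_ofK (lfrac m t).
case: (numer_of _) => m' t' /fracP[v vE].
case: (numer_of _) => r' s' /fracP[u uE]; apply/fracP.
exists (denomM u v); rewrite ?dvalE /= in uE vE *.
rewrite ?dvalE !scalerA.
transitivity ((dval u * dval s * r') *: ((dval v * dval t) *: m')).
  by rewrite scalerA; congr (_ *: _); ring.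
rewrite vE scalerA.
transitivity (((dval u * dval s) *: r' * (dval v * dval t')) *: m).
  by congr (_ *: _); rewrite /GRing.scale /=; ring.
by rewrite uE; congr (_ *: _); rewrite /GRing.scale /=; ring.
Qed.

Definition loc_ring : Type := localize R^o.
HB.instance Definition _ := GRing.Zmodule.on loc_ring.

Definition loc_mul (a b : loc_ring) : loc_ring := loc_scale a b.
Definition loc_one : loc_ring := lfrac (1 : R^o) denom1.

Section ScaleTheory.
Variable M : lmodType R.

Fact loc_scaleA (a b : loc_ring) (x : localize M) :
  loc_scale a (loc_scale b x) = loc_scale (loc_mul a b) x.
Proof.
elim/fracW: a => r s; elim/fracW: b => r' s'; elim/fracW: x => m t.
rewrite /loc_mul !loc_scaleE; apply: frac_eq.
rewrite ?dvalE /= !scalerA; congr (_ *: _); rewrite /GRing.scale /=; ring.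
Qed.

Fact loc_scale1 : left_id loc_one (@loc_scale M).
Proof.
elim/fracW => m t; rewrite loc_scaleE; apply: frac_eq.
by rewrite ?dvalE /= scale1r mul1r.
Qed.

Fact loc_scaleDr : right_distributive (@loc_scale M) +%R.
Proof.
elim/fracW => r s; elim/fracW => m t; elim/fracW => n u.
rewrite !fracD !loc_scaleE fracD; apply: frac_eq.
rewrite ?dvalE /= !scalerDr !scalerA.
by congr (_ + _); congr (_ *: _); ring.
Qed.

Fact loc_scaleDl (x : localize M) :
  {morph (@loc_scale M)^~ x : a b / a + b}.
Proof.
elim/fracW: x => m t; elim/fracW => r s; elim/fracW => r' s'.
rewrite fracD !loc_scaleE fracD; apply: frac_eq.
rewrite ?dvalE /= !scalerDr !scalerA -scalerDl; congr (_ *: _).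
by rewrite /GRing.scale /=; ring.
Qed.

End ScaleTheory.

Fact loc_mulA : associative loc_mul.
Proof. by move=> a b c; apply: loc_scaleA. Qed.
Fact loc_mulC : commutative loc_mul.
Proof.
elim/fracW => r s; elim/fracW => r' s'; rewrite /loc_mul !loc_scaleE.
by apply: frac_eq; rewrite ?dvalE /= /GRing.scale /=; ring.
Qed.
Fact loc_mul1 : left_id loc_one loc_mul.
Proof. exact: loc_scale1. Qed.
Fact loc_mulDl : left_distributive loc_mul +%R.
Proof. by move=> a b c; apply: loc_scaleDl. Qed.

HB.instance Definition _ := GRing.Zmodule_isComPzRing.Build loc_ring
  loc_mulA loc_mulC loc_mul1 loc_mulDl.

HB.instance Definition _ (M : lmodType R) :=
  GRing.Zmodule_isLmodule.Build loc_ring (localize M)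
    (@loc_scaleA M) (@loc_scale1 M) (@loc_scaleDr M) (@loc_scaleDl M).

End Localization.

Section Depth.
Variable A : comPzRingType.

Definition nonunit (a : A) : Prop := ~ exists b, a * b = 1.

Definition regular_seq (s : seq A^o) : Prop :=
  (forall i, (i < size s)%N -> forall a : A^o,
     in_span (take i s) (s`_i * a) -> in_span (take i s) a) /\
  ~ in_span s 1.

(* A local ring: its maximal ideal is the set of nonunits. *)
Definition depth_eq (d : nat) : Prop :=
  let regular_in_max s := regular_seq s /\ (forall a, a \in s -> nonunit a) in
  (exists2 s, regular_in_max s & size s = d) /\
  (forall s, regular_in_max s -> (size s <= d)%N).

End Depth.

(* Main.v *)
(* Let Z be the n-th syzygy of M.

   If Z is (n+1)-torsionfree it also has n + 1 cosyzygies along embeddings into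
   projectives whose duals are onto. Pushing out along these embeddings
   compares the i-th cosyzygy C of Z with the (n-i)-th syzygy Y of M: for some
   projective P there is a surjection C + P ->> Y with kernel K of projective
   dimension < i. For i = n we get M = (C + P)/K with C inside a projective Q,
   so M embeds in (Q + P)/K.

   Conversely, let M be contained in W with pd W <= n. One shows by induction on
   i <= n that the i-th cosyzygy C is torsionless. Since Ext^j(C, R) = 0 for
   1 <= j <= i, a torsion element of C dies in Y, hence lies in K. If it is
   nonzero, take an associated prime p of the submodule it generates. As K_p has
   projective dimension < i and a socle element, depth R_p < i <= n, so M_p has
   finite Gorenstein dimension. The socle element of K_p also gives
   the Auslander-Buchsbaum bound Gdim M_p <= n, without minimal resolutions:
   Hom(Ext^j(M_p, R_p), K_p) = Tor_j(M_p, K_p) = 0 for j >= i. Thus Z_p is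
   totally reflexive, its cosyzygy C_p is torsionless, and the torsion element
   vanishes in C_p, a contradiction. *)

Require Import Defs.
From HB Require Import structures.
From mathcomp Require Import all_boot all_algebra.
From mathcomp Require Import boolp ring.

Set Implicit Arguments.
Unset Strict Implicit.
Unset Printing Implicit Defensive.

Import GRing.Theory.
Local Open Scope ring_scope.

(** * Linear maps, submodules and short exact sequences *)

(** Neither Ext nor Tor is formed as a module. Only vanishing matters; it is stated as extending or
    lifting maps and moved between degrees along syzygies. Likewise Ext of the transpose is replaced
    by conditions on Z itself: Z is torsionless, it maps onto its bidual, and Ext of its dual
    vanishes in a range. In this form both directions rest on one shift: if Z embeds in a projective
    with onto dual, the cokernel has order of torsionfreeness exactly one less. The onto dual also
    drives the comparison with syzygies, since maps to any projective then extend along the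
    embedding. In the converse the cosyzygies are not given in advance: each exists only once the
    previous one is known to be torsionless, and the embedding of M in W enters only at i = n. The
    prime p is chosen from the torsion element so that K_p gets a nonzero socle element. It does the
    work of the residue field: a finitely generated V with Hom(V, K_p) = 0 is zero, which replaces
    Nakayama and minimality. *)

Section Submodule.
Variables (R : comPzRingType) (M : lmodType R) (N : M -> Prop).

Definition submodule_pred of is_submodule N : {pred M} := fun v => `[< N v >].

Variable subN : is_submodule N.

Lemma submodule_pred_closed : subsemimod_closed (submodule_pred subN).
Proof.
have [N0 ND NZ] := subN; split; first split.
- exact/asboolP.
- by move=> x y /asboolP Nx /asboolP Ny; apply/asboolP/ND.
- by move=> a x /asboolP Nx; apply/asboolP/NZ.
Qed.

HB.instance Definition _ :=
  GRing.isSubmodClosed.Build R M (submodule_pred subN) submodule_pred_closed.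

Definition submodule : Type := {v : M | v \in submodule_pred subN}.
HB.instance Definition _ := SubChoice.on submodule.
HB.instance Definition _ := [SubChoice_isSubLmodule of submodule by <:].

End Submodule.

Section LinearMaps.
Variable R : comPzRingType.
Implicit Types A B C D U V W M N : lmodType R.

Lemma linear_ex U V (f : U -> V) :
  linear f -> exists g : {linear U -> V}, forall x, g x = f x.
Proof.
move=> fl.
by exists (HB.pack f (GRing.isLinear.Build R U V *:%R f fl) : {linear U -> V}).
Qed.

(** A linear map is obtained from its graph, so diagram chases need no chosen representatives. By
    linearity, single-valuedness has to be checked only at 0. *)
Lemma linear_of_rel U V (r : U -> V -> Prop) :
  (forall x, exists y, r x y) ->
  (forall a x y x' y', r x y -> r x' y' -> r (a *: x + x') (a *: y + y')) ->
  (forall y, r 0 y -> y = 0) ->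
  exists2 f : {linear U -> V}, forall x, r x (f x) & forall x y, r x y -> f x = y.
Proof.
move=> tot lin r0.
have uni x y y' : r x y -> r x y' -> y' = y.
  move=> rxy rxy'; apply/eqP; rewrite -subr_eq0; apply/eqP; apply: r0.
  have := lin (-1) _ _ _ _ rxy rxy'.
  by rewrite !scaleN1r addNr addrC.
have [f fP] := choice tot.
have fl : linear f by move=> a x y; apply: (uni _ _ _ _ (fP _)); apply: lin.
have [g gE] := linear_ex fl.
by exists g => [x|x y rxy]; rewrite gE //; exact: uni rxy (fP x).
Qed.

Lemma factor_inj A B C (i : {linear A -> B}) (f : {linear C -> B}) :
  injective i -> (forall c, exists a, i a = f c) ->
  exists g : {linear C -> A}, forall c, i (g c) = f c.
Proof.
move=> ii fi; have [|||g gP _] := @linear_of_rel C A (fun c a => i a = f c).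
- exact: fi.
- by move=> a x y x' y' e e'; rewrite !linearP e e'.
- by move=> y; rewrite linear0 -(linear0 i) => /ii.
by exists g.
Qed.

Lemma factor_surj B C D (p : {linear B -> C}) (f : {linear B -> D}) :
  surjective p -> (forall b, p b = 0 -> f b = 0) ->
  exists g : {linear C -> D}, forall b, g (p b) = f b.
Proof.
move=> ps fp.
have [|||g _ gP] :=
    @linear_of_rel C D (fun c d => exists2 b, p b = c & f b = d).
- by move=> c; have [b <-] := ps c; exists (f b), b.
- move=> a x y x' y' [b <- <-] [b' <- <-].
  by exists (a *: b + b'); rewrite linearP.
- by move=> y [b pb0 <-]; apply: fp.
by exists g => b; apply: gP; exists b.
Qed.

Lemma submodule_ex M (N : M -> Prop) : is_submodule N ->
  exists (K : lmodType R) (k : {linear K -> M}),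
    injective k /\ forall m, N m <-> exists x, k x = m.
Proof.
move=> sN; exists (submodule sN), (val : {linear submodule sN -> M}).
split=> [|m]; first exact: val_inj.
split=> [Nm | [x <-]]; last by have /asboolP := valP x.
have mN : m \in submodule_pred sN by apply/asboolP.
by exists (Sub m mN).
Qed.

Lemma coker_proj U V (f : {linear U -> V}) :
  exists p : {linear V -> coker f},
    (forall c, exists v, p v = c) /\ (forall v, p v = 0 <-> exists u, f u = v).
Proof.
have [p pE] : exists p : {linear V -> coker f},
    forall v, p v = \pi_(Quotient.quot (in_image f))%qT v.
  apply: linear_ex => a x y.
  by rewrite -[a *: (_ : coker f)]/(coker_scale _ _) coker_piZ -coker_piD.
exists p; split=> [|v].
  by apply: (@coker_piW _ _ _ f) => v; exists v.
rewrite -(linear0 p) !pE; split=> [/eqP|[u <-]].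
  by rewrite -Quotient.idealrBE subr0 => /asboolP.
by apply/eqP; rewrite -Quotient.idealrBE subr0; apply/asboolP; exists u.
Qed.

Lemma cokernel_ex U V (f : {linear U -> V}) :
  exists (C : lmodType R) (p : {linear V -> C}), surjective p /\ exact f p.
Proof. by have [p pE] := coker_proj f; exists (coker f), p. Qed.

Lemma kernel_ex U V (f : {linear U -> V}) :
  exists (K : lmodType R) (k : {linear K -> U}), injective k /\ exact k f.
Proof.
apply: submodule_ex; split=> [|x y fx fy|a x fx]; first exact: linear0.
  by rewrite linearD fx fy addr0.
by rewrite linearZ /= fx scaler0.
Qed.

Definition copair A B C (f : {linear A -> C}) (g : {linear B -> C}) :
  {linear (A * B)%type -> C} := (f \o fst) \+ (g \o snd).

Lemma pair_ex A B C (f : {linear C -> A}) (g : {linear C -> B}) :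
  exists h : {linear C -> (A * B)%type}, forall c, h c = (f c, g c).
Proof. by apply: linear_ex => a x y; rewrite !linearP. Qed.

Definition ses A B C (i : {linear A -> B}) (p : {linear B -> C}) :=
  [/\ injective i, exact i p & surjective p].

Lemma ses0 A B C (i : {linear A -> B}) (p : {linear B -> C}) :
  ses i p -> forall a, p (i a) = 0.
Proof. by move=> [_ e _] a; apply/e; exists a. Qed.

Lemma inj0P A B (i : {linear A -> B}) :
  (forall a, i a = 0 -> a = 0) -> injective i.
Proof.
move=> i0 x y /eqP; rewrite -subr_eq0 -linearB => /eqP/i0/eqP.
by rewrite subr_eq0 => /eqP.
Qed.

Lemma inj0 A B (i : {linear A -> B}) a : injective i -> i a = 0 -> a = 0.
Proof. by move=> ii; rewrite -(linear0 i) => /ii. Qed.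

Lemma ses_ker B C (p : {linear B -> C}) : surjective p ->
  exists (A : lmodType R) (i : {linear A -> B}), ses i p.
Proof. by move=> ps; have [A [i [ii ei]]] := kernel_ex p; exists A, i. Qed.

Lemma ses_coker A B (i : {linear A -> B}) : injective i ->
  exists (C : lmodType R) (p : {linear B -> C}), ses i p.
Proof. by move=> ii; have [C [p [ps ep]]] := cokernel_ex i; exists C, p. Qed.

Lemma ses_prod A B :
  exists i : {linear A -> (A * B)%type}, ses i (snd : {linear (A * B)%type -> B}).
Proof.
have [i iE] := pair_ex (idfun : {linear A -> A}) (\0 : {linear A -> B}).
exists i; split=> [x y|[a b]|b]; last by exists (0, b).
  by rewrite !iE => -[].
split=> [/= ->|[a' <-]]; first by exists a; rewrite iE.
by rewrite iE.
Qed.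

Lemma ses_pullback A B C D (i : {linear A -> B}) (p : {linear B -> C})
    (f : {linear D -> C}) : ses i p ->
  exists (X : lmodType R) (b : {linear X -> B}) (d : {linear X -> D})
         (j : {linear A -> X}),
    [/\ forall x, p (b x) = f (d x), ses j d, forall a, b (j a) = i a
      & forall y z, p y = f z -> exists2 x, b x = y & d x = z].
Proof.
move=> [ii ei ps].
have [X [k [ki ke]]] :=
  kernel_ex ((p \o fst) \- (f \o snd) : {linear (B * D)%type -> C}).
have kE x : p (k x).1 = f (k x).2.
  by apply/eqP; rewrite -subr_eq0; apply/eqP; apply/ke; exists x.
have kS y z : p y = f z -> exists x, k x = (y, z).
  by move=> e; apply/ke; rewrite /= e subrr.
have [m mE] := pair_ex i (\0 : {linear A -> D}).
have [a|j jE] := factor_inj ki (f := m).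
  by rewrite mE; apply: kS; rewrite linear0; apply/ei; exists a.
exists X, (fst \o k), (snd \o k), j; split=> [x|||y z e] /=.
- exact: kE.
- split=> [x y /(congr1 k)|x|d] /=.
  + by rewrite !jE !mE => -[/ii].
  + split=> [x0|[a <-]]; last by rewrite jE mE.
    have /ei[a aE] : p (k x).1 = 0 by rewrite kE x0 linear0.
    by exists a; apply: ki; rewrite jE mE aE; case: (k x) x0 => /= b d ->.
  + have [b bE] := ps (f d); have [x xE] := kS _ _ bE.
    by exists x; rewrite xE.
- by move=> a; rewrite jE mE.
- by have [x xE] := kS _ _ e; exists x; rewrite xE.
Qed.

End LinearMaps.

(** * Finitely generated and projective modules *)

Section FinGen.
Variable R : comPzRingType.
Implicit Types A B C D U V W M N P : lmodType R.

Lemma submodule_sum M (N : M -> Prop) (I : Type) (r : seq I) (F : I -> M) :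
  is_submodule N -> (forall i, N (F i)) -> N (\sum_(i <- r) F i).
Proof. by move=> [N0 ND _] NF; elim/big_ind: _. Qed.

Lemma in_span_submodule M (s : seq M) : is_submodule (in_span s).
Proof.
split.
- by exists (fun=> 0); rewrite big1 // => i _; rewrite scale0r.
- move=> _ _ [a ->] [b ->]; exists (fun i => a i + b i).
  by rewrite -big_split; apply: eq_bigr => i _; rewrite scalerDl.
- move=> c _ [a ->]; exists (fun i => c * a i).
  by rewrite scaler_sumr; apply: eq_bigr => i _; rewrite scalerA.
Qed.

Lemma in_span_mem M (s : seq M) y : y \in s -> in_span s y.
Proof.
move=> ys; exists (fun k => (k == index y s)%:R).
have ls : (index y s < size s)%N by rewrite index_mem.
rewrite (bigD1 (Ordinal ls)) //= eqxx scale1r nth_index // big1 ?addr0 // => i.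
by rewrite -val_eqE /= => /negPf ->; rewrite scale0r.
Qed.

Lemma in_spanW M (s : seq M) (N : M -> Prop) x :
  is_submodule N -> (forall y, y \in s -> N y) -> in_span s x -> N x.
Proof.
move=> sN Ns [a ->]; apply: submodule_sum => // i.
by have [_ _ NZ] := sN; apply/NZ/Ns/mem_nth.
Qed.

Definition generates M (I : finType) (e : I -> M) :=
  forall x, exists a : I -> R, x = \sum_i a i *: e i.

Lemma fin_genP M : fin_gen M <-> exists (I : finType) (e : I -> M), generates e.
Proof.
split=> [[s sP]|[I [e eP]]].
  exists 'I_(size s), (fun i : 'I_(size s) => s`_i) => x; have [a ->] := sP x.
  by exists (fun i : 'I_(size s) => a i).
exists (codom e) => x; have [a ->] := eP x.
apply: submodule_sum; first exact: in_span_submodule.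
move=> i; have [_ _ sZ] := in_span_submodule (codom e).
by apply/sZ/in_span_mem/codom_f.
Qed.

Lemma fin_gen_surj B C (p : {linear B -> C}) :
  surjective p -> fin_gen B -> fin_gen C.
Proof.
move=> ps /fin_genP[I [e eP]]; apply/fin_genP; exists I, (p \o e) => c.
have [b <-] := ps c; have [a ->] := eP b; exists a.
by rewrite linear_sum; apply: eq_bigr => i _; rewrite linearZ.
Qed.

Lemma fin_gen_ext A B C (i : {linear A -> B}) (p : {linear B -> C}) :
  ses i p -> fin_gen A -> fin_gen C -> fin_gen B.
Proof.
move=> [_ ei ps] /fin_genP[I [e eP]] /fin_genP[J [f fP]].
have [g gP] := choice (fun j => ps (f j)).
apply/fin_genP; exists (I + J)%type,
  (fun k => match k with inl k => i (e k) | inr k => g k end) => b.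
have [c cE] := fP (p b).
have /ei[a aE] : p (b - \sum_j c j *: g j) = 0.
  rewrite linearB linear_sum cE; apply/eqP; rewrite subr_eq0; apply/eqP.
  by apply: eq_bigr => j _; rewrite linearZ /= gP.
have [d dE] := eP a.
exists (fun k => match k with inl k => d k | inr k => c k end).
rewrite big_sumType /= -[LHS](subrK (\sum_j c j *: g j)) -aE dE linear_sum.
by congr (_ + _); apply: eq_bigr => j _; rewrite linearZ.
Qed.

Lemma rV_map_ex M m (e : 'I_m -> M) :
  exists f : {linear 'rV[R]_m -> M}, forall x, f x = \sum_i x 0 i *: e i.
Proof.
apply: linear_ex => a x y; rewrite scaler_sumr -big_split.
by apply: eq_bigr => i _; rewrite !mxE scalerDl scalerA.
Qed.

Lemma rV_cover M : fin_gen M ->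
  exists m (f : {linear 'rV[R]_m -> M}), surjective f.
Proof.
move=> [s sP]; have [f fE] := rV_map_ex (fun i : 'I_(size s) => s`_i).
exists (size s), f => x; have [a ->] := sP x; exists (\row_i a i).
by rewrite fE; apply: eq_bigr => i _; rewrite mxE.
Qed.

(** The r with r y in the image of D form an ideal, and preimages of its finitely many generators
    generate D. *)
Lemma fin_gen_sub_cyclic C D (d : {linear D -> C}) (y : C) :
  noetherian R -> injective d -> (forall z, exists r : R, d z = r *: y) ->
  fin_gen D.
Proof.
move=> nR id dy; pose I (r : R^o) := exists z, d z = r *: y.
have [|s sP] := nR I.
  split=> [|a b [u uE] [v vE]|a b [u uE]].
  - by exists 0; rewrite linear0 scale0r.
  - by exists (u + v); rewrite linearD uE vE scalerDl.
  - by exists (a *: u); rewrite linearZ /= uE scalerA.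
have sI (i : 'I_(size s)) : exists z, d z = s`_i *: y.
  by apply/sP/in_span_mem/mem_nth.
have [g gE] := choice sI.
apply/fin_genP; exists 'I_(size s), g => z.
have [r rE] := dy z; have [|a aE] := (sP r).1; first by exists z.
exists (fun i : 'I_(size s) => a i); apply: id; rewrite rE aE linear_sum scaler_suml.
by apply: eq_bigr => i _; rewrite linearZ /= gE scalerA.
Qed.

(** Induction on the number of generators of B. With B' spanned by all generators but one, A is an
    extension of a submodule of the cyclic module B / B' by a submodule of B'. *)
Lemma fin_gen_sub A B (i : {linear A -> B}) :
  noetherian R -> injective i -> fin_gen B -> fin_gen A.
Proof.
move=> nR ii [s]; have [n] := ubnP (size s).
elim: n A B i s ii => // n IH A B i [|x s] ii ss sP.
  exists [::] => a; exists (fun=> 0); apply: ii.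
  by have [c ->] := sP (i a); rewrite !big_ord0 linear0.
have [B' [j [ij jE]]] := submodule_ex (in_span_submodule s).
have [C [p pP]] := ses_coker ij; have [_ ep ps] := pP.
have [A' [k [ik ek]]] := kernel_ex (p \o i : {linear A -> C}).
have [D [q qP]] := ses_coker ik; have [_ eq qs] := qP.
apply: (fin_gen_ext qP).
  have [a|l lE] := factor_inj ij (f := i \o k).
    by apply/ep/(ek (k a)); exists a.
  (* [h] picks preimages in B' of the elements of the span, with default 0 outside it. *)
  have [y|h hE] := @choice _ _ (fun y b => in_span s y -> j b = y).
    have [/jE[b <-]|nsy] := pselect (in_span s y); first by exists b.
    by exists 0 => /nsy.
  apply: (IH _ _ l (map h s)) => [u v /(congr1 j)||b].
  - by rewrite !lE => /ii/ik.
  - by rewrite size_map.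
  have /jE[c cE] : exists b', j b' = j b by exists b.
  exists c; apply: ij; rewrite cE linear_sum size_map; apply: eq_bigr => m _.
  by rewrite linearZ (nth_map 0) //= hE //; apply/in_span_mem/mem_nth.
have [b|f fE] := factor_surj qs (f := p \o i).
  by move/eq => [a' <-]; apply/ek; exists a'.
apply: (@fin_gen_sub_cyclic C D f (p x)) => //.
  apply: inj0P => z; have [a <-] := qs z; rewrite fE => /ek[a' <-].
  by apply/eq; exists a'.
move=> z; have [a <-] := qs z; rewrite fE /=; have [c ->] := sP (i a).
exists (c 0); rewrite big_ord_recl linearD linearZ /=.
rewrite [X in _ + X](_ : _ = 0) ?addr0 //; apply/ep/jE.
by exists (fun k => c k.+1).
Qed.

End FinGen.

(** * Projective modules through dual bases *)

Section Projective.
Variable R : comPzRingType.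
Implicit Types A B C D U V W M N P Q : lmodType R.

Definition dual_basis P (I : finType) (e : I -> P) (h : I -> dual P) :=
  forall x, x = \sum_i dual_fun (h i) x *: e i.

(** The dual basis criterion turns projectivity into finite data that can be dualized and localized
    term by term. *)
Lemma fg_projectiveP P : fg_projective P <->
  exists (I : finType) (e : I -> P) (h : I -> dual P), dual_basis e h.
Proof.
split=> [[fgP pP]|[I [e [h hP]]]].
  have [m [f fs]] := rV_cover fgP.
  have [s sE] := pP _ _ f (idfun : {linear P -> P}) fs.
  have hl (i : 'I_m) : linear ((fun x => s x 0 i) : P -> R^o).
    by move=> a x y; rewrite linearP !mxE.
  exists 'I_m, (fun i => f (delta_mx 0 i)), (fun i => linear_pack (hl i)) => x.
  rewrite -{1}[x]sE {1}(row_sum_delta (s x)) linear_sum.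
  by apply: eq_bigr => i _; rewrite linearZ.
split.
  by apply/fin_genP; exists I, e => x; exists (fun i => dual_fun (h i) x).
move=> A B g f gs; have [a aE] := choice (fun i => gs (f (e i))).
have [k kE] : exists k : {linear P -> A},
    forall x, k x = \sum_i dual_fun (h i) x *: a i.
  apply: linear_ex => c x y; rewrite scaler_sumr -big_split /=.
  by apply: eq_bigr => i _; rewrite /dual_fun linearP scalerDl scalerA.
exists k => x; rewrite kE linear_sum {2}[x]hP linear_sum.
by apply: eq_bigr => i _; rewrite !linearZ /= aE.
Qed.

Lemma fg_projective_retract P Q (a : {linear Q -> P}) (b : {linear P -> Q}) :
  (forall x, b (a x) = x) -> fg_projective P -> fg_projective Q.
Proof.
move=> ba [fP pP]; split; first by apply: (fin_gen_surj (p := b)) fP => x; exists (a x).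
move=> A B g f gs; have [h hE] := pP _ _ g (f \o b) gs.
by exists (h \o a) => x; rewrite /= hE /= ba.
Qed.

Lemma fg_projective_rV m : fg_projective ('rV[R]_m : lmodType R).
Proof.
have hl (i : 'I_m) : linear ((fun x : 'rV[R]_m => x 0 i) : _ -> R^o).
  by move=> a x y; rewrite !mxE.
apply/fg_projectiveP.
exists 'I_m, (fun i => delta_mx 0 i), (fun i => linear_pack (hl i)) => x.
exact: row_sum_delta.
Qed.

Lemma fg_projective_regular : fg_projective (R^o : lmodType R).
Proof.
apply/fg_projectiveP; exists 'I_1, (fun=> 1), (fun=> (idfun : {linear R^o -> R^o})).
by move=> x; rewrite big_ord1 /= /GRing.scale /= mulr1.
Qed.

Lemma fg_projective_0 P : (forall x : P, x = 0) -> fg_projective P.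
Proof.
move=> P0; apply: (@fg_projective_retract R^o _ \0 \0) => [x|].
  by rewrite [x]P0.
exact: fg_projective_regular.
Qed.

Lemma fg_projective_prod P Q :
  fg_projective P -> fg_projective Q -> fg_projective (P * Q)%type.
Proof.
move=> [fP pP] [fQ pQ]; split.
  by have [i ii] := ses_prod P Q; apply: (fin_gen_ext ii).
have [i [iE _ _]] := ses_prod P Q.
move=> A B g f gs.
have [j jE] := pair_ex (idfun : {linear P -> P}) (\0 : {linear P -> Q}).
have [k kE] := pair_ex (\0 : {linear Q -> P}) (idfun : {linear Q -> Q}).
have [u uE] := pP _ _ g (f \o j) gs; have [v vE] := pQ _ _ g (f \o k) gs.
exists (copair u v) => -[x y].
rewrite /copair /= linearD uE vE /= jE kE -linearD; congr (f _).
by congr pair; rewrite /= ?addr0 ?add0r.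
Qed.

Lemma projective_cover M : fin_gen M ->
  exists P (A : lmodType R) (i : {linear A -> P}) (p : {linear P -> M}),
    fg_projective P /\ ses i p.
Proof.
move=> fM; have [m [f fs]] := rV_cover fM; have [A [i iE]] := ses_ker fs.
exists ('rV[R]_m : lmodType R), A, i, f; split=> //; exact: fg_projective_rV.
Qed.

Lemma ses_section A B C (i : {linear A -> B}) (p : {linear B -> C})
    (s : {linear C -> B}) : ses i p -> (forall c, p (s c) = c) ->
  exists2 r : {linear B -> A}, forall b, i (r b) = b - s (p b)
    & forall a, r (i a) = a.
Proof.
move=> sip ps; have [ii ei _] := sip.
have [b|r rE] := factor_inj ii (f := idfun \- (s \o p)).
  by apply/ei; rewrite linearB /= ps subrr.
exists r => // a; apply: ii.
by rewrite rE /= (ses0 sip) linear0 subr0.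
Qed.

Lemma fg_projective_ker A B C (i : {linear A -> B}) (p : {linear B -> C}) :
  ses i p -> fg_projective B -> fg_projective C -> fg_projective A.
Proof.
move=> sip fB [_ pC]; have [ii ei ps] := sip.
have [s sE] := pC _ _ p (idfun : {linear C -> C}) ps.
have [r _ rE] := ses_section sip sE.
exact: (fg_projective_retract rE).
Qed.

(** * Duals *)

Definition torsionless M :=
  forall x : M, (forall h : dual M, dual_fun h x = 0) -> x = 0.

Definition bidual_onto M :=
  forall f : {linear dual M -> R^o}, exists x, forall h, f h = dual_fun h x.

Lemma dual_sumE M (I : finType) (h : I -> dual M) x :
  dual_fun (\sum_i h i) x = \sum_i dual_fun (h i) x.
Proof. by apply: (big_morph (fun g => dual_fun g x)). Qed.

Lemma dual_map_linE U V (f : {linear U -> V}) (h : dual V) x :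
  dual_fun (dual_map f h) x = dual_fun h (f x).
Proof. by []. Qed.

Lemma dual_basis_dual P (I : finType) (e : I -> P) (h : I -> dual P) :
  dual_basis e h -> forall f : dual P, f = \sum_i dual_fun f (e i) *: h i.
Proof.
move=> eh f; apply: dual_ext => x; rewrite dual_sumE {1}[x]eh.
rewrite {1}/dual_fun linear_sum; apply: eq_bigr => i _.
by rewrite linearZ; exact: mulrC.
Qed.

Lemma projective_torsionless P : fg_projective P -> torsionless P.
Proof.
move=> /fg_projectiveP[I [e [h eh]]] x x0; rewrite [x]eh big1 // => i _.
by rewrite x0 scale0r.
Qed.

Lemma projective_bidual P : fg_projective P -> bidual_onto P.
Proof.
move=> /fg_projectiveP[I [e [h eh]]] f; exists (\sum_i f (h i) *: e i) => g.
rewrite {1}[g](dual_basis_dual eh) linear_sum {2}/dual_fun linear_sum.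
by apply: eq_bigr => i _; rewrite !linearZ; exact: mulrC.
Qed.

Lemma fg_projective_dual P : fg_projective P -> fg_projective (dual P).
Proof.
move=> /fg_projectiveP[I [e [h eh]]]; apply/fg_projectiveP.
have el i : linear ((fun g : dual P => dual_fun g (e i)) : _ -> R^o) by [].
exists I, h, (fun i => linear_pack (el i)) => g.
exact: dual_basis_dual.
Qed.

Lemma torsionless_sub A B (i : {linear A -> B}) :
  injective i -> torsionless B -> torsionless A.
Proof.
move=> ii tB x x0; apply: (inj0 ii); apply: tB => h.
by rewrite -dual_map_linE x0.
Qed.

Lemma dual_inj B C (p : {linear B -> C}) :
  surjective p -> injective (dual_map p).
Proof.
move=> ps g h e; apply: dual_ext => c; have [b <-] := ps c.
by rewrite -!dual_map_linE e.
Qed.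

Lemma fin_gen_dual M : noetherian R -> fin_gen M -> fin_gen (dual M).
Proof.
move=> nR /rV_cover[m [f fs]]; apply: (fin_gen_sub nR (dual_inj fs)).
by have [] := fg_projective_dual (fg_projective_rV m).
Qed.

End Projective.

(** * Vanishing of Ext *)

Section ExtVanishing.
Variable R : comPzRingType.
Implicit Types A B C D F K U V W X M N P Q : lmodType R.

(** For N = R this says that the dual of i is onto. *)
Definition extends_along N A B (i : {linear A -> B}) :=
  forall f : {linear A -> N}, exists g : {linear B -> N}, forall a, g (i a) = f a.

Definition Ext1_zero B N := forall U V (i : {linear U -> V}) (p : {linear V -> B}),
  ses i p -> extends_along N i.

(* Ext^j(B, N) = 0 for 1 <= j <= k, by dimension shifting. *)
Fixpoint Ext_zero k B N : Prop :=
  if k is k'.+1 then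
    Ext1_zero B N /\
    forall P B' (i : {linear B' -> P}) (p : {linear P -> B}),
      fg_projective P -> ses i p -> Ext_zero k' B' N
  else True.

Lemma Ext_zero1 k B N : Ext_zero k.+1 B N -> Ext1_zero B N.
Proof. by case. Qed.

Lemma Ext_zeroS k B N : Ext_zero k.+1 B N -> Ext_zero k B N.
Proof.
elim: k B => // k IH B [e1 eS]; split=> // P B' i p fP sip.
by apply: IH; apply: eS fP sip.
Qed.

Lemma Ext_zero_le k l B N : (k <= l)%N -> Ext_zero l B N -> Ext_zero k B N.
Proof. by move/subnK <-; elim: (l - k)%N => // m IH; rewrite addSn => /Ext_zeroS. Qed.

Lemma Ext_zero_trivial k B N : (forall x : N, x = 0) -> Ext_zero k B N.
Proof.
move=> N0; elim: k B => // k IH B; split=> [U V i p _ f|P B' i p _ _].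
  by exists \0 => a; rewrite [RHS]N0 [LHS]N0.
exact: IH.
Qed.

Lemma extends_along_projective A B (i : {linear A -> B}) F : fg_projective F ->
  extends_along (R^o : lmodType R) i -> extends_along F i.
Proof.
move=> /fg_projectiveP[I [e [h eh]]] ei f.
have /choice[g gE] j : exists g : {linear B -> R^o},
    forall a, g (i a) = dual_fun (h j) (f a).
  by have [g gE] := ei ((h j : {linear F -> R^o}) \o f); exists g.
have [k kE] : exists k : {linear B -> F}, forall b, k b = \sum_j g j b *: e j.
  apply: linear_ex => c x y; rewrite scaler_sumr -big_split /=.
  by apply: eq_bigr => j _; rewrite linearP scalerDl scalerA.
by exists k => a; rewrite kE [RHS]eh; apply: eq_bigr => j _; rewrite gE.
Qed.

Lemma Ext_zero_coef_projective k B F : fg_projective F ->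
  Ext_zero k B (R^o : lmodType R) -> Ext_zero k B F.
Proof.
move=> fF; elim: k B => // k IH B [e1 eS]; split=> [U V i p /e1|P B' i p fP].
  exact: extends_along_projective.
by move/(eS _ _ _ _ fP)/IH.
Qed.

(** Any extension V of B by U is a quotient of P + U by a copy of A, so a map on U extends to V once
    its pullback to A extends to P. *)
Lemma Ext1_zero_cover P A B N (i : {linear A -> P}) (p : {linear P -> B}) :
  projective P -> ses i p -> extends_along N i -> Ext1_zero B N.
Proof.
move=> pP sip ei U V j q [ij ej qs] u; have [ii ep ps] := sip.
have [l lE] := pP _ _ q p qs.
have [x|a aE] := factor_inj ij (f := l \o i).
  by apply/ej; rewrite /= lE (ses0 sip).
have [g gE] := ei (u \o a).
have [||w wE] := @factor_surj _ _ _ _ (copair l j) (copair g u).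
- move=> v; have [x xE] := ps (q v).
  have /ej[y yE] : q (v - l x) = 0 by rewrite linearB lE xE subrr.
  by exists (x, y); rewrite /copair /= yE addrC subrK.
- case=> x y; rewrite /copair /= => xy0.
  have /ep[z zE] : p x = 0.
    by rewrite -lE -[l x](addrK (j y)) xy0 sub0r linearN (_ : q _ = 0) ?oppr0 //;
      apply/ej; exists y.
  rewrite -zE gE /=; move: xy0; rewrite -zE -[l (i z)]aE -linearD => /(inj0 ij) az.
  by rewrite -linearD az linear0.
exists w => y; have := wE (0, y).
by rewrite /copair /= !linear0 !add0r.
Qed.

(* The kernel V1 of V -> C is an extension of A by U. *)
Lemma ses_over A M C U V (i : {linear A -> M}) (p : {linear M -> C})
    (j : {linear U -> V}) (q : {linear V -> M}) : ses i p -> ses j q ->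
  exists (V1 : lmodType R) (k : {linear V1 -> V}) (l : {linear U -> V1})
         (m : {linear V1 -> A}),
    [/\ ses k (p \o q), ses l m, forall u, k (l u) = j u
      & forall v, i (m v) = q (k v)].
Proof.
move=> [ii ep ps] sjq; have [ij eq qs] := sjq.
have [V1 [k skp]] : exists (V1 : lmodType R) (k : {linear V1 -> V}), ses k (p \o q).
  apply: ses_ker => c; have [m <-] := ps c; have [v <-] := qs m.
  by exists v.
have [ik ek _] := skp.
have [u|l lE] := factor_inj ik (f := j).
  by apply/ek; rewrite /= (ses0 sjq) linear0.
have [v|m mE] := factor_inj ii (f := q \o k).
  by apply/ep; apply/(ek (k v)); exists v.
exists V1, k, l, m; split=> //; split=> [x y|v|a].
- by move=> /(congr1 k); rewrite !lE => /ij.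
- split=> [v0|[u <-]].
    have /eq[u uE] : q (k v) = 0 by rewrite -[LHS]mE v0 linear0.
    by exists u; apply: ik; rewrite lE.
  by apply: ii; rewrite mE /= lE (ses0 sjq) linear0.
- have [v vE] := qs (i a).
  have /ek[w wE] : (p \o q) v = 0 by apply/ep; exists a.
  by exists w; apply: ii; rewrite mE /= wE.
Qed.

Lemma Ext1_zero_ext A M C N (i : {linear A -> M}) (p : {linear M -> C}) :
  ses i p -> Ext1_zero A N -> Ext1_zero C N -> Ext1_zero M N.
Proof.
move=> sip eA eC U V j q sjq u.
have [V1 [k [l [m [skp slm kl _]]]]] := ses_over sip sjq.
have [g gE] := eA _ _ _ _ slm u; have [h hE] := eC _ _ _ _ skp g.
by exists h => a; rewrite -kl hE.
Qed.

(** The pullback of two surjections onto C is an extension in two ways; when one side is projective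
    this is Schanuel's argument. *)
Lemma ses_pullback2 A B A' B' C (i : {linear A -> B}) (p : {linear B -> C})
    (i' : {linear A' -> B'}) (p' : {linear B' -> C}) : ses i p -> ses i' p' ->
  exists (X : lmodType R) (b : {linear X -> B}) (b' : {linear X -> B'})
         (j : {linear A -> X}) (j' : {linear A' -> X}), ses j b' /\ ses j' b.
Proof.
move=> sip sip'; have [ii' ep' ps'] := sip'.
have [X [b [b' [j [bE sj bj bS]]]]] := ses_pullback p' sip.
have [h hE] := pair_ex b b'; have [_ ej _] := sj.
have ih : injective h.
  apply: inj0P => x; rewrite hE => -[bx /ej[a ax]].
  by move: bx; rewrite -ax bj => /inj0 -> //; [rewrite linear0 | case: sip].
have [m mE] := pair_ex (\0 : {linear A' -> B}) i'.
have [a|j' jE] := factor_inj ih (f := m).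
  have [|x xE xE'] := bS 0 (i' a); first by rewrite linear0 (ses0 sip').
  by exists x; rewrite hE xE xE' mE.
exists X, b, b', j, j'; split=> //; split=> [x y|x|y].
- by move/(congr1 h); rewrite !jE !mE => -[/ii'].
- split=> [bx|[a <-]]; last by have := jE a; rewrite hE mE => -[].
  have /ep'[a aE] : p' (b' x) = 0 by rewrite -bE bx linear0.
  by exists a; apply: ih; rewrite jE mE hE bx aE.
- have [z zE] := ps' (p y); have [|x xE _] := bS y z; first by rewrite zE.
  by exists x.
Qed.

Lemma ses_summand A X C U V (i : {linear A -> X}) (p : {linear X -> C})
    (s : {linear C -> X}) (j : {linear U -> V}) (q : {linear V -> A}) :
  ses i p -> (forall c, p (s c) = c) -> ses j q ->
  exists k : {linear U -> (V * C)%type}, (forall u, k u = (j u, 0)) /\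
    ses k (copair (i \o q) s).
Proof.
move=> sip ps [ij ej qs]; have [ii ep _] := sip.
have [k kE] := pair_ex j (\0 : {linear U -> C}); exists k; split=> //; split.
- by move=> x y; rewrite !kE => -[/ij].
- move=> [v c]; rewrite /copair /=; split=> [e|[u]].
    have c0 : c = 0.
      move/(congr1 p): e; rewrite linearD (ses0 sip) ps add0r => ->.
      exact: linear0.
    move: e; rewrite c0 linear0 addr0 => /(inj0 ii)/ej[u uE].
    by exists u; rewrite kE /= uE.
  rewrite kE => -[<- <-]; rewrite linear0 addr0.
  by rewrite (_ : q _ = 0) ?linear0 //; apply/ej; exists u.
- move=> x; have /ep[a aE] : p (x - s (p x)) = 0 by rewrite linearB ps subrr.
  have [v vE] := qs a; exists (v, p x).
  by rewrite /copair /= vE aE subrK.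
Qed.

Lemma Ext_zero_summand k A X P N (i : {linear A -> X}) (p : {linear X -> P}) :
  fg_projective P -> ses i p -> Ext_zero k X N -> Ext_zero k A N.
Proof.
move=> fP sip; case: k => // k [e1 eS]; have [_ pP] := fP.
have [_ _ ps] := sip.
have [s sE] := pP _ _ p (idfun : {linear P -> P}) ps.
split=> [U V j q /(ses_summand sip sE)[l [lE sl]] u|P' A' j q fP'].
  have [g gE] := e1 _ _ _ _ sl u.
  have [h hE] := pair_ex (idfun : {linear V -> V}) (\0 : {linear V -> P}).
  by exists (g \o h) => x; rewrite /= hE -gE lE.
move=> /(ses_summand sip sE)[l [_ sl]].
by apply: eS sl; apply: fg_projective_prod.
Qed.

Lemma Ext_zero_projective k P N : fg_projective P -> Ext_zero k P N.
Proof.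
elim: k P => // k IH P fP; have [_ pP] := fP; split=> [U V i p sip u|P' P'' i p fP' sip].
  have [_ _ ps] := sip.
  have [s sE] := pP _ _ p (idfun : {linear P -> P}) ps.
  have [r _ rE] := ses_section sip sE.
  by exists (u \o r) => a; rewrite /= rE.
exact/IH/(fg_projective_ker sip).
Qed.

Section Noetherian.
Hypothesis nR : noetherian R.

Lemma fin_gen_ses A B C (i : {linear A -> B}) (p : {linear B -> C}) :
  ses i p -> fin_gen B -> fin_gen A /\ fin_gen C.
Proof.
move=> [ii _ ps] fB; split; first exact: (fin_gen_sub nR ii).
exact: (fin_gen_surj ps).
Qed.

(** Two pieces of the long exact sequence, proved together: in each degree the claim on kernels
    follows from the one on extensions, and it yields the claim on extensions one degree up. *)
Lemma Ext_zero_ext_ker k N :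
  (forall A M C (i : {linear A -> M}) (p : {linear M -> C}),
     ses i p -> fin_gen A ->
     Ext_zero k A N -> Ext_zero k C N -> Ext_zero k M N) /\
  (forall A M C (i : {linear A -> M}) (p : {linear M -> C}),
     ses i p -> fin_gen C ->
     Ext_zero k M N -> Ext_zero k.+1 C N -> Ext_zero k A N).
Proof.
have ker l : (forall A M C (i : {linear A -> M}) (p : {linear M -> C}),
     ses i p -> fin_gen A ->
     Ext_zero l A N -> Ext_zero l C N -> Ext_zero l M N) ->
  forall A M C (i : {linear A -> M}) (p : {linear M -> C}), ses i p ->
    fin_gen C -> Ext_zero l M N -> Ext_zero l.+1 C N -> Ext_zero l A N.
  move=> ext A M C i p sip fC eM [_ eC].
  have [P [C1 [j [q [fP sjq]]]]] := projective_cover fC.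
  (* X is an extension of P by A, hence has A as a summand, and it is also an extension of M by
     C1. *)
  have [X [b [b' [h [h' [sh sh']]]]]] := ses_pullback2 sip sjq.
  apply: Ext_zero_summand sh _ => //; apply: ext sh' _ _ _ => //.
    by have [] := fin_gen_ses sjq fP.1.
  exact: eC _ _ _ _ fP sjq.
suff ext : forall A M C (i : {linear A -> M}) (p : {linear M -> C}),
     ses i p -> fin_gen A ->
     Ext_zero k A N -> Ext_zero k C N -> Ext_zero k M N.
  by split=> //; exact: ker.
elim: k => // k IH A M C i p sip fA eA eC.
split; first by apply: Ext1_zero_ext sip _ _; [case: eA | case: eC].
move=> P M1 j q fP sjq.
(* The syzygy C1 of C is an extension of A by the syzygy M1 of M, so M1 is reached by the claim on
   kernels. *)
have [C1 [h [l [m [sh slm _ _]]]]] := ses_over sip sjq.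
apply: (ker _ IH) slm fA _ eA.
by case: eC => _; apply; [exact: fP | exact: sh].
Qed.

Lemma Ext_zero_ext k A M C N (i : {linear A -> M}) (p : {linear M -> C}) :
  ses i p -> fin_gen A -> Ext_zero k A N -> Ext_zero k C N -> Ext_zero k M N.
Proof. exact: (Ext_zero_ext_ker k N).1. Qed.

Lemma Ext_zero_ker k A M C N (i : {linear A -> M}) (p : {linear M -> C}) :
  ses i p -> fin_gen C -> Ext_zero k M N -> Ext_zero k.+1 C N -> Ext_zero k A N.
Proof. exact: (Ext_zero_ext_ker k N).2. Qed.

(** One cover of B decides, although [Ext_zero] quantifies over all of them: two syzygies of B agree
    up to projective summands. *)
Lemma Ext_zero_cover k P A B N (i : {linear A -> P}) (p : {linear P -> B}) :
  fg_projective P -> ses i p -> extends_along N i -> Ext_zero k A N ->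
  Ext_zero k.+1 B N.
Proof.
move=> fP sip ei eA; split.
  exact: Ext1_zero_cover fP.2 sip ei.
move=> P' A' i' p' fP' sip'.
have [X [b [b' [j [j' [sj sj']]]]]] := ses_pullback2 sip sip'.
apply: (Ext_zero_ker sj' fP.1); last exact: Ext_zero_projective.
apply: (Ext_zero_ext sj _ eA); last exact: Ext_zero_projective.
by have [] := fin_gen_ses sip fP.1.
Qed.

(** In the long exact sequence Ext^j(C, N) lies between Ext^(j-1)(A, N) and Ext^j(M, N); for j = 1
    the left contribution vanishes because maps extend along i. *)
Lemma Ext_zero_coker k A M C N (i : {linear A -> M}) (p : {linear M -> C}) :
  ses i p -> fin_gen M -> extends_along N i -> Ext_zero k A N ->
  Ext_zero k.+1 M N -> Ext_zero k.+1 C N.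
Proof.
move=> sip fM ei eA [e1 eM].
have [P [M1 [j [q [fP sjq]]]]] := projective_cover fM.
have [C1 [h [l [m [sh slm hl im]]]]] := ses_over sip sjq.
apply: (Ext_zero_cover fP sh); last first.
  apply: (Ext_zero_ext slm _ _ eA); last exact: eM _ _ _ _ fP sjq.
  by have [] := fin_gen_ses sjq fP.1.
(* Extend [f \o l] to P first; the remaining error factors through A and extends to M. *)
move=> f; have [g gE] := e1 _ _ _ _ sjq (f \o l).
have [_ em ms] := slm.
have [c /em[u <-]|t tE] := factor_surj ms (f := f \- (g \o h)).
  by rewrite /= hl gE subrr.
have [t' t'E] := ei t; exists (g \+ (t' \o q)) => c.
by rewrite /= -im t'E tE /= addrC subrK.
Qed.

(** The pullback of the sequence along u splits, since Ext^1(B, K') = 0. *)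
Lemma Ext1_zero_lift B K' F K (i : {linear K' -> F}) (p : {linear F -> K})
    (u : {linear B -> K}) :
  ses i p -> Ext1_zero B K' -> exists w : {linear B -> F}, forall b, p (w b) = u b.
Proof.
move=> sip eB; have [X [b [d [j [bd sj bj _]]]]] := ses_pullback u sip.
have [r rE] := eB _ _ _ _ sj (idfun : {linear K' -> K'}).
have [_ ed ds] := sj.
have [x /ed[y <-]|w wE] := factor_surj ds (f := b \- (i \o r)).
  by rewrite /= bj rE subrr.
exists w => z; have [x <-] := ds z.
by rewrite wE /= linearB (ses0 sip) subr0 bd.
Qed.

(** Ext^j(B, K) lies between Ext^j(B, F) and Ext^(j+1)(B, K'). *)
Lemma Ext_zero_coef k B K' F K (i : {linear K' -> F}) (p : {linear F -> K}) :
  ses i p -> fin_gen B -> Ext_zero k B F -> Ext_zero k.+1 B K' -> Ext_zero k B K.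
Proof.
move=> sip; elim: k B => // k IH B fB [e1 eF] [_ eK'].
split=> [|P B' j q fP sjq].
  have [P [B' [j [q [fP sjq]]]]] := projective_cover fB.
  apply: (Ext1_zero_cover fP.2 sjq) => u.
  have [w wE] := Ext1_zero_lift u sip (Ext_zero1 (eK' _ _ _ _ fP sjq)).
  have [g gE] := e1 _ _ _ _ sjq w.
  by exists (p \o g) => a; rewrite /= gE wE.
apply: IH; [|exact: eF _ _ _ _ fP sjq|exact: eK' _ _ _ _ fP sjq].
by have [] := fin_gen_ses sjq fP.1.
Qed.

End Noetherian.
End ExtVanishing.

(** * Resolutions *)

Section Resolutions.
Variable R : comPzRingType.
Implicit Types A B K M N P Q T U V Z : lmodType R.
Local Notation RR := (R^o : lmodType R).

Section Prepend.
Variables (C : lmodType R -> Prop) (T' P T : lmodType R).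
Variables (i : {linear T' -> P}) (p : {linear P -> T}) (sip : ses i p) (CP : C P).
Variable F : resolution C T'.

Definition prepend_res k : lmodType R := if k is k'.+1 then F k' else P.

Definition prepend_map k : {linear prepend_res k.+1 -> prepend_res k} :=
  if k is k'.+1 return {linear prepend_res k.+1 -> prepend_res k}
  then res_map F k' else i \o res_aug F.

Fact prepend_class k : C (prepend_res k).
Proof. by case: k => //= k; apply: res_class. Qed.

Fact prepend_surj : surjective p. Proof. by case: sip. Qed.

Fact prepend_exact0 : exact (prepend_map 0) p.
Proof.
move=> v; have [_ e _] := sip; split=> [/e[t <-]|[u <-]]; last first.
  by apply/e; exists (res_aug F u).
by have [u <-] := res_surj F t; exists u.
Qed.

Fact prepend_exactS k : exact (prepend_map k.+1) (prepend_map k).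
Proof.
case: k => [|k] /=; last exact: res_exactS.
move=> v /=; split=> [/inj0 v0|/(res_exact0 (r := F) v) ->]; last exact: linear0.
by apply/res_exact0/v0; case: sip.
Qed.

Definition prepend : resolution C T :=
  Resolution prepend_class prepend_surj prepend_exact0 prepend_exactS.

End Prepend.

Section Tail.
Variables (C : lmodType R -> Prop) (T K : lmodType R) (F : resolution C T).
Variables (a : {linear F 1%N -> K}) (sa : surjective a) (ea : exact (res_map F 1) a).

Definition tail : resolution C K :=
  @Resolution _ C K (fun k => F k.+1) (fun k => res_map F k.+1) a
    (fun k => res_class F k.+1) sa ea (fun k => @res_exactS _ _ _ F k.+1).

End Tail.

Lemma res_tail_ex C T (F : resolution C T) :
  exists K (k : {linear K -> F 0}) (a : {linear F 1%N -> K}),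
    [/\ ses k (res_aug F), surjective a, exact (res_map F 1) a
      & forall x, k (a x) = res_map F 0 x].
Proof.
have [K [k sk]] := ses_ker (@res_surj _ _ _ F); have [ik ek _] := sk.
have [x|a aE] := factor_inj ik (f := res_map F 0).
  by apply/ek/res_exact0; exists x.
exists K, k, a; split=> // [x|x].
  have /res_exact0[y yE] : res_aug F (k x) = 0 by rewrite (ses0 sk).
  by exists y; apply: ik; rewrite aE.
rewrite -(res_exactS (r := F) (i := 0) x) -aE; split=> [->|/(inj0 ik) //].
exact: linear0.
Qed.

(** Bundled as a type so that covers can be chosen by a function, as an infinite resolution
    requires. *)
Record cover M := Cover {
  cover_mod : lmodType R;
  cover_ker : lmodType R;
  cover_inc : {linear cover_ker -> cover_mod};
  cover_map : {linear cover_mod -> M};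
  cover_proj : fg_projective cover_mod;
  cover_ses : ses cover_inc cover_map }.

Lemma resolution_ex M : noetherian R -> fin_gen M ->
  exists F : resolution (@fg_projective R) M, True.
Proof.
move=> nR fM.
have cov (N : {N : lmodType R | fin_gen N}) : cover (sval N).
  apply: (projT1 (cid (P := fun=> True) _)).
  have [P [K [i [p [fP sip]]]]] := projective_cover (svalP N).
  by exists (Cover fP sip).
have fK (N : {N : lmodType R | fin_gen N}) : fin_gen (cover_ker (cov N)).
  by have [] := fin_gen_ses nR (cover_ses (cov N)) (cover_proj (cov N)).1.
pose S := fix S k : {N : lmodType R | fin_gen N} :=
  if k is k'.+1 then exist _ _ (fK (S k')) else exist _ M fM.
pose c k := cov (S k).
pose F k := cover_mod (c k).
pose p k : {linear F k -> sval (S k)} := cover_map (c k).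
pose i k : {linear sval (S k.+1) -> F k} := cover_inc (c k).
have sip k : ses (i k) (p k) := cover_ses (c k).
pose d k : {linear F k.+1 -> F k} := i k \o p k.+1.
have ex (A : lmodType R) k (f : {linear F k -> A}) :
  (forall x, f x = 0 <-> p k x = 0) -> exact (d k) f.
  move=> fp v; have [_ e _] := sip k; have [_ _ s] := sip k.+1.
  rewrite fp e; split=> [[u <-]|[u <-]]; last by exists (p k.+1 u).
  by have [w <-] := s u; exists w.
have cl k : fg_projective (F k) := cover_proj (c k).
have s0 : surjective (p 0 : {linear F 0 -> M}) by case: (sip 0).
unshelve eexists; last by [].
apply: (Resolution cl s0 (res_map := d)); first exact: ex.
move=> k; apply: ex => x; have [ii _ _] := sip k.
by split=> [/(inj0 ii)|e] //; rewrite /d /= e linear0.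
Qed.

(* Resolutions of length < n: n = 0 forces M = 0, and n.+1 bounds dimension by n. *)
Fixpoint resolvable (C : lmodType R -> Prop) n M : Prop :=
  if n is n'.+1 then
    exists P M' (i : {linear M' -> P}) (p : {linear P -> M}),
      [/\ C P, ses i p & resolvable C n' M']
  else forall x : M, x = 0.

Lemma resolution_resolvable C n M (F : resolution C M) :
  (forall k, (n <= k)%N -> forall x : F k, x = 0) -> resolvable C n M.
Proof.
elim: n M F => [|n IH] M F F0 /=.
  by move=> x; have [y <-] := res_surj F x; rewrite [y]F0 // linear0.
have [K [k [a [sk sa ea _]]]] := res_tail_ex F.
exists (F 0%N), K, k, (res_aug F); split=> //; first exact: res_class.
by apply: (IH _ (tail sa ea)) => j nj; apply: F0.
Qed.

Lemma resolvable_resolution n M : resolvable (@fg_projective R) n M ->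
  exists F : resolution (@fg_projective R) M,
    forall k, (n <= k)%N -> forall x : F k, x = 0.
Proof.
elim: n M => [|n IH] M /=; last first.
  move=> [P [M' [i [p [fP sip /IH[F F0]]]]]].
  by exists (prepend sip fP F) => -[|k] // nk; apply: F0.
move=> M0.
have ex : exact (\0 : {linear M -> M}) (\0 : {linear M -> M}).
  by move=> x; split=> // _; exists 0; rewrite [x]M0.
have sj : surjective (\0 : {linear M -> M}) by move=> x; exists 0; rewrite [x]M0.
by exists (Resolution (fun=> fg_projective_0 M0) sj ex (fun=> ex)).
Qed.

Lemma proj_dim_leP M n : proj_dim_le M n <-> resolvable (@fg_projective R) n.+1 M.
Proof.
split=> [[F F0]|/resolvable_resolution[F F0]]; last by exists F.
exact: resolution_resolvable F0.
Qed.

(** Each step down the resolution of K costs one degree of Ext against R. As K has projective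
    dimension at most j - 1, degree k + 1 against K is paid for by degrees up to j + k against R. *)
Lemma Ext_zero_resolvable k j B K :
  noetherian R -> fin_gen B ->
  resolvable (@fg_projective R) j K -> Ext_zero (j + k) B RR -> Ext_zero k.+1 B K.
Proof.
move=> nR fB; elim: j k K => [|j IH] k K.
  by move=> K0 _; apply: Ext_zero_trivial.
move=> [F [K' [i [p [fF sip rK']]]]] eB.
apply: (Ext_zero_coef nR sip fB); last by apply: IH rK' _; rewrite addnS.
apply: Ext_zero_coef_projective => //; apply: Ext_zero_le eB.
by rewrite addSn ltnS leq_addl.
Qed.

Lemma dual_map0P U V (f : {linear U -> V}) (h : dual V) :
  dual_map f h = 0 <-> forall x, dual_fun h (f x) = 0.
Proof.
by split=> [e x|e]; [rewrite -dual_map_linE e | apply: dual_ext => x; exact: e].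
Qed.

Lemma Ext_vanishesS T' P T (i : {linear T' -> P}) (p : {linear P -> T}) j :
  fg_projective P -> ses i p -> Ext_vanishes j.+2 T -> Ext_vanishes j.+1 T'.
Proof. by move=> fP sip eT F f /(eT (prepend sip fP F)). Qed.

Lemma Ext_vanishes1 T' P T (i : {linear T' -> P}) (p : {linear P -> T}) :
  noetherian R -> fg_projective P -> ses i p -> Ext_vanishes 1 T ->
  extends_along RR i.
Proof.
move=> nR fP sip eT f; have [fT' _] := fin_gen_ses nR sip fP.1.
have [F _] := resolution_ex nR fT'.
have [|g gE] := eT (prepend sip fP F) (f \o res_aug F).
  apply/dual_map0P => x; rewrite /dual_fun /=.
  by rewrite (res_exact0 (r := F) _).2 ?linear0 //; exists x.
exists g => t; have [x <-] := res_surj F t.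
by have /(congr1 (fun h => dual_fun h x)) := gE.
Qed.

Lemma Ext_vanishes_zero k T : noetherian R -> fin_gen T ->
  (forall i, (1 <= i <= k)%N -> Ext_vanishes i T) -> Ext_zero k T RR.
Proof.
move=> nR; elim: k T => // k IH T fT eT; split.
  have [P [K [i [p [fP sip]]]]] := projective_cover fT.
  apply: (Ext1_zero_cover fP.2 sip); apply: (Ext_vanishes1 nR fP sip).
  exact: eT.
move=> P K i p fP sip; apply: IH => [|j /andP[j0 jk]].
  by have [] := fin_gen_ses nR sip fP.1.
by case: j j0 jk => // j _ jk; apply: Ext_vanishesS sip _ => //; apply: eT.
Qed.

Lemma Ext_zero_vanishes i k T :
  Ext_zero k T RR -> (1 <= i <= k)%N -> Ext_vanishes i T.
Proof.
case: i => // i eT /= ik F f fc.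
elim: i k ik T F eT f fc => [|i IH] [//|k] ik T F [e1 eS] f /dual_map0P fc;
  have [K [j [a [sj sa ea jE]]]] := res_tail_ex F.
  have [|g gE] := factor_surj sa (f := (f : {linear _ -> RR})).
    by move=> x /ea[y <-]; apply: fc.
  have [h hE] := e1 _ _ _ _ sj g; exists h; apply: dual_ext => x.
  by rewrite dual_map_linE -jE [RHS]hE [RHS]gE.
have eK : Ext_zero k K RR by apply: eS sj; apply: res_class.
by apply: (IH k ik K (tail sa ea) eK f); apply/dual_map0P.
Qed.

End Resolutions.

(** * Torsionfree modules *)

Section Torsionfree.
Variable R : comPzRingType.
Implicit Types A B C K M N P Q T U V X Z : lmodType R.
Local Notation RR := (R^o : lmodType R).

Lemma eval_ex M (x : M) :
  exists f : {linear dual M -> R^o}, forall h, f h = dual_fun h x.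
Proof. exact: linear_ex. Qed.

Lemma ses_dual A B C (i : {linear A -> B}) (p : {linear B -> C}) :
  ses i p -> extends_along RR i -> ses (dual_map p) (dual_map i).
Proof.
move=> sip ei; have [_ ep ps] := sip.
split=> [|h|h]; first exact: dual_inj.
  rewrite dual_map0P; split=> [h0|[u <-] a]; last first.
    by rewrite dual_map_linE (ses0 sip) /dual_fun linear0.
  have [b /ep[a <-]|g gE] := factor_surj ps (f := (h : {linear _ -> RR})).
    exact: h0.
  by exists g; apply: dual_ext.
by have [g gE] := ei h; exists g; apply: dual_ext.
Qed.

Lemma bidual_onto_extends B C (p : {linear B -> C}) :
  surjective p -> bidual_onto C -> extends_along RR (dual_map p).
Proof.
move=> ps oC f; have [c cE] := oC f; have [b bE] := ps c.
by have [g gE] := eval_ex b; exists g => h; rewrite gE cE dual_map_linE bE.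
Qed.

Lemma extends_bidual_onto B C (p : {linear B -> C}) :
  bidual_onto B -> extends_along RR (dual_map p) -> bidual_onto C.
Proof.
move=> oB ep f; have [g gE] := ep f; have [b bE] := oB g.
by exists (p b) => h; rewrite -gE bE.
Qed.

Section Step.
Variables (Z Q C : lmodType R) (i : {linear Z -> Q}) (p : {linear Q -> C}).
Hypotheses (sip : ses i p) (ei : extends_along RR i).

(** Evaluation at a lift x of c vanishes on the dual of C, so it factors through the dual of Z and
    is evaluation at some z. Then x = i z, as Q is torsionless. *)
Lemma bidual_onto_coker : torsionless Q -> bidual_onto Z -> torsionless C.
Proof.
move=> tQ oZ c c0; have [_ ep ps] := sip; have [x xE] := ps c.
have [f fE] := eval_ex x.
have [_ ed ds] := ses_dual sip ei.
have [h /ed[u <-]|g gE] := factor_surj ds (f := f).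
  by rewrite fE dual_map_linE xE.
have [z zE] := oZ g; rewrite -xE; apply/ep; exists z.
apply/eqP; rewrite -subr_eq0; apply/eqP/tQ => h.
rewrite /dual_fun linearB [X in X - _]/= -[h _]/(dual_fun (dual_map i h) z).
by rewrite -zE gE fE subrr.
Qed.

Lemma coker_bidual_onto : bidual_onto Q -> torsionless C -> bidual_onto Z.
Proof.
move=> oQ tC f; have [_ ep _] := sip; have [_ _ ds] := ses_dual sip ei.
have [x xE] := oQ (f \o dual_map i).
have /ep[z zE] : p x = 0.
  apply: tC => h; rewrite -dual_map_linE -xE /= (ses0 (ses_dual sip ei)).
  exact: linear0.
exists z => h; have [g <-] := ds h.
by rewrite dual_map_linE zE -xE.
Qed.

End Step.

(* For finitely generated Z this says Ext^i(Tr Z, R) = 0 for 1 <= i <= k; see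
   [transpose_tfree]. *)
Definition tfree k Z : Prop :=
  match k with
  | 0 => True
  | 1 => torsionless Z
  | k'.+2 => [/\ torsionless Z, bidual_onto Z & Ext_zero k' (dual Z) RR]
  end.

Lemma tfree_torsionless k Z : tfree k.+1 Z -> torsionless Z.
Proof. by case: k => //= k []. Qed.

Hypothesis nR : noetherian R.

(** The dual sequence is exact, and each condition drops by one place: Z maps onto its bidual iff C
    is torsionless, Ext^1 of the dual of Z decides whether C maps onto its bidual, and higher Ext of
    the duals shifts. *)
Lemma tfree_step k Z Q C (i : {linear Z -> Q}) (p : {linear Q -> C}) :
  fg_projective Q -> ses i p -> extends_along RR i ->
  tfree k.+1 Z <-> tfree k C.
Proof.
move=> fQ sip ei; have [ii _ ps] := sip.
have tQ := projective_torsionless fQ; have oQ := projective_bidual fQ.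
have tZ := torsionless_sub ii tQ.
have sd := ses_dual sip ei; have fQ' := fg_projective_dual fQ.
case: k => [//|[|k]] /=.
  split=> [[_ oZ _]|tC]; first exact: bidual_onto_coker sip ei tQ oZ.
  by split=> //; apply: coker_bidual_onto sip ei oQ tC.
split=> [[_ oZ [e1 eS]]|[tC oC eC]].
  split; first exact: bidual_onto_coker sip ei tQ oZ.
    apply: (extends_bidual_onto (projective_bidual fQ)).
    exact: e1 sd.
  exact: eS sd.
split=> //; first exact: coker_bidual_onto sip ei oQ tC.
by apply: Ext_zero_cover sd _ eC => //; apply: bidual_onto_extends.
Qed.

(** Generators of the dual of Z serve as coordinates: they separate points, and every functional is
    a combination of them, hence extends. *)
Lemma torsionless_embed Z : fin_gen Z -> torsionless Z ->
  exists Q C (i : {linear Z -> Q}) (p : {linear Q -> C}),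
    [/\ fg_projective Q, ses i p & extends_along RR i].
Proof.
move=> fZ tZ; have [s sP] := fin_gen_dual nR fZ.
have [i iE] : exists i : {linear Z -> 'rV[R]_(size s)},
    forall z, i z = \row_k dual_fun s`_k z.
  apply: linear_ex => a x y; apply/rowP => k.
  by rewrite !mxE /dual_fun linearP.
have ii : injective i.
  apply: inj0P => z iz; apply: tZ => h; have [a ->] := sP h.
  rewrite dual_sumE big1 // => k _.
  rewrite -[LHS]/(a k * dual_fun s`_k z).
  by move/rowP/(_ k): iz; rewrite iE !mxE => ->; rewrite mulr0.
have [C [p sip]] := ses_coker ii.
exists ('rV[R]_(size s) : lmodType R), C, i, p; split=> //.
  exact: fg_projective_rV.
move=> f; have [a aE] := sP f.
have [g gE] := rV_map_ex (fun k : 'I_(size s) => a k : RR).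
exists g => z; rewrite gE iE -[RHS]/(dual_fun f z) aE dual_sumE.
by apply: eq_bigr => k _; rewrite mxE; apply: mulrC.
Qed.

(** * Ext of the transpose in terms of the bidual *)

Section Transpose.
Variables (P1 P0 Z T T1 : lmodType R).
Variables (d : {linear P1 -> P0}) (e : {linear P0 -> Z}).
Variables (j : {linear T1 -> dual P1}) (q : {linear dual P1 -> T}).
Variable (r : {linear dual P0 -> T1}).
Hypotheses (fP1 : fg_projective P1) (fP0 : fg_projective P0).
Hypotheses (ed : exact d e) (es : surjective e) (sjq : ses j q).
Hypotheses (rs : surjective r) (jr : forall h, j (r h) = dual_map d h).

Lemma transpose_ses : ses (dual_map e) r.
Proof.
have [ij _ _] := sjq; split=> [|h|//]; first exact: dual_inj.
split=> [r0|[u <-]]; last first.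
  apply: (inj0 ij); rewrite jr; apply/dual_map0P => x.
  by rewrite dual_map_linE (ed (d x)).2 ?/dual_fun ?linear0 //; exists x.
have /dual_map0P h0 : dual_map d h = 0 by rewrite -jr r0 linear0.
have [b /ed[a <-]|g gE] := factor_surj es (f := (h : {linear _ -> RR})).
  exact: h0.
by exists g; apply: dual_ext.
Qed.

(** T1 is the image of the dual of d. A functional on T1 pulls back to evaluation at some x in P0
    with e x torsion; if e x = 0, then x = d y and evaluation at y extends it. *)
Lemma torsionless_transpose : torsionless Z <-> extends_along RR j.
Proof.
have str := transpose_ses; have [_ er _] := str; split=> [tZ f|ej z z0].
  have [x xE] := projective_bidual fP0 (f \o r).
  have /ed[y yE] : e x = 0.
    by apply: tZ => h; rewrite -dual_map_linE -xE /= (ses0 str) linear0.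
  have [g gE] := eval_ex y; exists g => t; have [h <-] := rs t.
  by rewrite jr gE dual_map_linE yE -xE.
have [x xE] := es z; have [f fE] := eval_ex x.
have [h /er[u <-]|g gE] := factor_surj rs (f := f).
  by rewrite fE dual_map_linE xE.
have [k kE] := ej g; have [y yE] := projective_bidual fP1 k.
rewrite -xE; apply/ed; exists y.
apply/eqP; rewrite -subr_eq0; apply/eqP/(projective_torsionless fP0) => h.
rewrite /dual_fun linearB -[h (d y)]/(dual_fun (dual_map d h) y).
by rewrite -yE -jr kE gE fE subrr.
Qed.

(** The dual of Z is a second syzygy of T, through T1. The three conditions in [tfree] are Ext^1 of
    T, Ext^1 of T1 and Ext of the dual of Z. *)
Lemma tfree_transpose k : tfree k Z <-> Ext_zero k T RR.
Proof.
have str := transpose_ses; have fP1' := fg_projective_dual fP1.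
have fP0' := fg_projective_dual fP0.
have e1T : Ext1_zero T RR <-> torsionless Z.
  rewrite torsionless_transpose; split=> [eT|]; first exact: eT sjq.
  exact: Ext1_zero_cover fP1'.2 sjq.
have e1T1 : Ext1_zero T1 RR <-> bidual_onto Z.
  split=> [eT|oZ].
    by apply: (extends_bidual_onto (projective_bidual fP0)); exact: eT str.
  by apply: (Ext1_zero_cover fP0'.2 str); apply: bidual_onto_extends.
case: k => [//|[|k]] /=; first by rewrite e1T; split=> [|[]].
split=> [[tZ oZ eZ]|[/e1T tZ eS]].
  apply: (Ext_zero_cover (k := k.+1) nR fP1' sjq); first exact/torsionless_transpose.
  apply: (Ext_zero_cover (k := k) nR fP0' str) => //.
  exact: bidual_onto_extends.
have [/e1T1 oZ eS'] := eS _ _ _ _ fP1' sjq; split=> //.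
exact: eS' fP0' str.
Qed.

End Transpose.

Lemma transpose_tfree Z (P : presentation Z) k :
  tfree k Z <-> Ext_zero k (transpose P) RR.
Proof.
have [q [qs qe]] := coker_proj (dual_map (pres_map P)).
have [T1 [j sjq]] := @ses_ker _ _ (transpose P) q qs.
have [ij ej _] := sjq.
have [h|r rE] := factor_inj ij (f := dual_map (pres_map P)).
  by apply/ej/qe; exists h.
apply: (tfree_transpose (pres1_proj P) (pres0_proj P) _ _ sjq _ rE).
- exact: pres_exact.
- exact: pres_surj.
move=> t; have /qe[h hE] : q (j t) = 0 by apply/ej; exists t.
by exists h; apply: ij; rewrite rE.
Qed.

Lemma presentation_ex Z : fin_gen Z -> exists P : presentation Z, True.
Proof.
move=> fZ; have [F _] := resolution_ex nR fZ.
by exists (Presentation (res_class F 1) (res_class F 0)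
             (res_exact0 (r := F)) (res_surj F)).
Qed.

Lemma fin_gen_transpose Z (P : presentation Z) : fin_gen (transpose P).
Proof.
have [q [qs _]] := coker_proj (dual_map (pres_map P)).
apply: (@fin_gen_surj _ _ (transpose P) q qs).
by have [] := fg_projective_dual (pres1_proj P).
Qed.

Lemma torsionfreeP k Z : fin_gen Z -> torsionfree k Z <-> tfree k Z.
Proof.
move=> fZ; split=> [tZ|tZ P i ik].
  have [P _] := presentation_ex fZ; apply/(transpose_tfree P).
  apply: (Ext_vanishes_zero nR (fin_gen_transpose P)) => i ik.
  exact: tZ ik.
by apply: Ext_zero_vanishes ik; apply/transpose_tfree.
Qed.

End Torsionfree.

(** * Syzygies against cosyzygies *)

Section Linkage.
Variable R : comPzRingType.
Implicit Types A B C K M N P Q T U V W X Y Z : lmodType R.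
Local Notation RR := (R^o : lmodType R).
Local Notation pdim_lt := (resolvable (@fg_projective R)).

Fixpoint syz n M Z : Prop :=
  if n is n'.+1 then
    exists N P (i : {linear Z -> P}) (p : {linear P -> N}),
      [/\ fg_projective P, ses i p & syz n' M N]
  else Z = M.

(** [syz] peels off the last step, but comparing resolutions of M needs the first. *)
Lemma syz_head n M Z : syz n.+1 M Z ->
  exists M' P (i : {linear M' -> P}) (p : {linear P -> M}),
    [/\ fg_projective P, ses i p & syz n M' Z].
Proof.
elim: n Z => [|n IH] Z [N [P [i [p [fP sip sN]]]]].
  by move: sN i p sip => /= -> i p sip; exists Z, P, i, p.
have [M' [Q [j [q [fQ sjq sN']]]]] := IH _ sN.
by exists M', Q, j, q; split=> //; exists N, P, i, p.
Qed.

Lemma syzygy_ses N (P : presentation N) :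
  exists i : {linear syzygy P -> pres0 P}, ses i (pres_aug P).
Proof.
exists (val : {linear image_module (pres_map P) -> pres0 P}).
split=> [|v|]; [exact: val_inj | | exact: pres_surj].
rewrite (pres_exact v); split=> [[u <-]|[x <-]]; last by have /asboolP := valP x.
have uN : pres_map P u \in in_image (pres_map P) by apply/asboolP; exists u.
by exists (Sub (pres_map P u) uN).
Qed.

Lemma is_syzygy_syz M n N : is_syzygy M n N -> syz n M N.
Proof.
elim=> [//|{}n {}N P _ sN]; have [i sip] := syzygy_ses P.
by exists N, (pres0 P), i, (pres_aug P); split=> //; apply: pres0_proj.
Qed.

Definition linked j C Y :=
  exists P K (k : {linear K -> (C * P)%type}) (f : {linear (C * P)%type -> Y}),
    [/\ fg_projective P, ses k f & pdim_lt j K].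

Lemma linked_refl Z : linked 0 Z Z.
Proof.
have P0 (x : 'rV[R]_0) : x = 0 by apply/rowP => -[].
have sf : surjective (fst : {linear (Z * 'rV[R]_0)%type -> Z}).
  by move=> z; exists (z, 0).
have [K [k sk]] := ses_ker sf.
exists ('rV[R]_0 : lmodType R), K, k, fst; split=> //.
  exact: fg_projective_rV.
move=> x; have [ik _ _] := sk; apply: (inj0 ik).
by have := ses0 sk x; case: (k x) => /= z p ->; rewrite [p]P0.
Qed.

(** As the dual of i is onto, C -> Y -> P' extends to g : Q -> P', which induces C' -> Y'. The
    kernel K' of C' + P' ->> Y' is covered by Q + P with kernel K again, so the dimension bound
    rises by one. *)
Lemma linked_step j C Q C' Y P' Y' (i : {linear C -> Q}) (p : {linear Q -> C'})
    (i' : {linear Y -> P'}) (p' : {linear P' -> Y'}) :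
  fg_projective Q -> ses i p -> extends_along RR i ->
  fg_projective P' -> ses i' p' -> linked j C Y -> linked j.+1 C' Y'.
Proof.
move=> fQ sip ei fP' sip' [P [K [k [f [fP skf rK]]]]].
have [ii ep ps] := sip; have [ii' ep' ps'] := sip'; have [ik ef fs] := skf.
have [jC jCE] := pair_ex (idfun : {linear C -> C}) (\0 : {linear C -> P}).
have [jP jPE] := pair_ex (\0 : {linear P -> C}) (idfun : {linear P -> P}).
have fE c x : f (c, x) = f (jC c) + f (jP x).
  rewrite -linearD jCE jPE; congr (f _).
  by congr pair; rewrite /= ?addr0 ?add0r.
have [g gE] := extends_along_projective fP' ei (i' \o f \o jC).
have [q /ep[c <-]|f' f'E] := factor_surj ps (f := p' \o g).
  by rewrite /= gE (ses0 sip').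
have Fs : surjective (copair f' p').
  by move=> y; have [x xE] := ps' y; exists (0, x); rewrite /copair /= linear0 add0r.
have [K' [k' skF]] := ses_ker Fs; have [ik' eF _] := skF.
(* [u] sends (q, x) to (p q, i' f(0, x) - g q). This dies in Y', and it is zero exactly on the pairs
   (- i c, x) with (c, x) in K. *)
have [u uE] := pair_ex (p \o fst : {linear (Q * P)%type -> C'})
  ((i' \o f \o jP \o snd) \- (g \o fst)).
have [[q x]|v vE] := factor_inj ik' (f := u).
  by apply/eF; rewrite uE /copair /= f'E /= linearB (ses0 sip') sub0r subrr.
have [w wE] := pair_ex (\- (i \o fst \o k)) (snd \o k).
exists P', K', k', (copair f' p'); split=> //.
exists (Q * P)%type, K, w, v; split=> //; first exact: fg_projective_prod.
split=> [|[q x]|z].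
- apply: inj0P => z; rewrite wE => -[/eqP]; rewrite oppr_eq0 => /eqP/(inj0 ii) z1 z2.
  by apply: (inj0 ik); case: (k z) z1 z2 => /= ? ? -> ->.
- split=> [v0|[z]].
    have : u (q, x) = 0 by rewrite -vE v0 linear0.
    rewrite uE /= => -[/ep[c cE]]; rewrite -cE gE /= -!linearB => /(inj0 ii') e.
    have /ef[z zE] : f (- c, x) = 0.
      by rewrite fE !linearN addrC -linearB.
    by exists z; rewrite wE /= zE /= linearN opprK cE.
  rewrite wE => -[<- <-] /=; apply: ik'; rewrite linear0 vE uE /=.
  rewrite !linearN (ses0 sip) gE oppr0 opprK /= -linearD addrC -fE -surjective_pairing.
  by rewrite (ses0 skf) linear0.
- have := ses0 skF z; rewrite /copair /=.
  case E : (k' z) => [c y] /=; have [q qE] := ps c.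
  rewrite -qE f'E /= -linearD => /ep'[y' y'E].
  have [[c' x] xE] := fs y'.
  exists (q - i c', x); apply: ik'; rewrite vE uE E /=; congr pair.
    by rewrite linearB (ses0 sip) subr0.
  rewrite linearB gE opprB /= addrA -linearD [f _ + f _]addrC -fE xE y'E.
  by rewrite addrAC subrr add0r.
Qed.

Lemma linked_embed n C Q M (i : {linear C -> Q}) :
  injective i -> fg_projective Q -> linked n C M ->
  exists2 W, fin_gen W /\ pdim_lt n.+1 W & exists f : {linear M -> W}, injective f.
Proof.
move=> ii fQ [P [K [k [f [fP skf rK]]]]]; have [ik ef fs] := skf.
have [h hE] := pair_ex (i \o fst : {linear (C * P)%type -> Q}) snd.
have [W [b sab]] : exists W (b : {linear (Q * P)%type -> W}), ses (h \o k) b.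
  apply: ses_coker; apply: inj0P => x /=; rewrite hE => -[/(inj0 ii) z1 z2].
  by apply: (inj0 ik); case: (k x) z1 z2 => /= ? ? -> ->.
have [_ eb bs] := sab; have fQP := fg_projective_prod fQ fP.
exists W; first split; first exact: fin_gen_surj bs fQP.1.
  by exists (Q * P)%type, K, (h \o k), b.
have [x /ef[z <-]|m mE] := factor_surj fs (f := b \o h).
  exact: (ses0 sab).
exists m; apply: inj0P => y; have [x <-] := fs y; rewrite mE => /eb[z zE].
apply/ef; exists z; move: zE; rewrite /= !hE => -[/ii e1 e2].
by case: (k z) (x) e1 e2 => ? ? [? ?] /= -> ->.
Qed.

Hypothesis nR : noetherian R.

(** j + n stays constant: each step uses up one syzygy and raises the bound on the kernel by one. *)
Lemma tfree_linked_embed n j C Y M : fin_gen C -> linked j C Y -> syz n M Y ->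
  tfree n.+1 C ->
  exists2 W, fin_gen W /\ pdim_lt (j + n).+1 W &
    exists f : {linear M -> W}, injective f.
Proof.
elim: n j C Y => [|n IH] j C Y fC lCY sY tC;
  have [Q [C' [i [p [fQ sip ei]]]]] := torsionless_embed nR fC (tfree_torsionless tC).
  have [ii _ _] := sip; rewrite addn0; rewrite sY in lCY.
  exact: linked_embed ii fQ lCY.
have [Y' [P' [i' [p' [fP' sip' sY']]]]] := sY.
rewrite addnS -addSn; apply: (IH j.+1 C' Y') => //.
- by have [] := fin_gen_ses nR sip fQ.1.
- exact: (linked_step fQ sip ei fP' sip' lCY).
- exact/(tfree_step nR n.+1 fQ sip ei).
Qed.

Lemma embed_of_syzygy_tfree M n N : syz n M N -> fin_gen N -> tfree n.+1 N ->
  exists2 W, fin_gen W /\ proj_dim_le W n & exists f : {linear M -> W}, injective f.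
Proof.
move=> sN fN tN.
have [W [fW rW] eW] := tfree_linked_embed fN (linked_refl N) sN tN.
by exists W => //; split=> //; apply/proj_dim_leP.
Qed.

End Linkage.

(** * Depth *)

Section Depth.
Variable R : comPzRingType.
Implicit Types A B C F K M N P Q T U V W X Y Z : lmodType R.
Local Notation RR := (R^o : lmodType R).
Local Notation pdim_lt := (resolvable (@fg_projective R)).
Hypothesis nR : noetherian R.

(** A reason for a to kill Ext^i(B, N) for i > 0 that, unlike a B = 0, is inherited by syzygies. *)
Definition factors_through_projective (a : R) B :=
  exists P (f : {linear B -> P}) (g : {linear P -> B}),
    projective P /\ forall x, g (f x) = a *: x.

Lemma factors_through_cover a P B B' (i : {linear B' -> P}) (p : {linear P -> B}) :
  ses i p -> factors_through_projective a B ->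
  exists t : {linear P -> B'}, forall x, t (i x) = a *: x.
Proof.
move=> sip [P' [f [g [pP' gf]]]]; have [ii ep ps] := sip.
have [h hE] := pP' _ _ p g ps.
have [x|t tE] := factor_inj ii (f := ( *:%R a : {linear P -> P}) \- (h \o f \o p)).
  by apply/ep; rewrite /= linearB hE gf linearZ subrr.
exists t => x; apply: ii.
by rewrite tE /= (ses0 sip) (linear0 f) (linear0 h) subr0 linearZ.
Qed.

Definition quotient_by (a : R) N N' (q : {linear N -> N'}) :=
  [/\ forall x : N, a *: x = 0 -> x = 0, surjective q
    & forall x, q x = 0 <-> exists y, a *: y = x].

(* Multiplication by a kills Ext(B, N), so Ext^i(B, N/aN) = 0 forces
   Ext^(i+1)(B, N) = 0. *)
Lemma Ext_zero_regular k a B N N' (q : {linear N -> N'}) :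
  fin_gen B -> quotient_by a q -> factors_through_projective a B ->
  (forall g : {linear B -> N'}, exists w : {linear B -> N}, forall b, q (w b) = g b) ->
  Ext_zero k B N' -> Ext_zero k.+1 B N.
Proof.
move=> fB [a0 qs qe] aB lB eB.
have e1 D : fin_gen D -> factors_through_projective a D ->
    (forall g : {linear D -> N'}, exists w : {linear D -> N}, forall b, q (w b) = g b) ->
    Ext1_zero D N.
  move=> fD aD lD; have [P [B' [i [p [fP sip]]]]] := projective_cover fD.
  apply: (Ext1_zero_cover fP.2 sip) => f; have [_ ep ps] := sip.
  have [t tE] := factors_through_cover sip aD.
  (* [f \o t] extends a f. Subtracting a lift of the map it induces to N' makes it divisible by a,
     and the quotient extends f. *)
  have [x /ep[y <-]|g gE] := factor_surj ps (f := q \o f \o t).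
    by apply/qe; exists (f y); rewrite /= tE linearZ.
  have [w wE] := lD g.
  have ia : injective ( *:%R a : {linear N -> N}) by apply: inj0P => x /a0.
  have [x|v vE] := factor_inj ia (f := (f \o t) \- (w \o p)).
    by apply/qe; rewrite /= linearB wE gE subrr.
  exists v => x; apply: ia.
  by rewrite vE /= (ses0 sip) linear0 subr0 tE linearZ.
elim: k B fB aB lB eB => [|k IH] B fB aB lB eB; split=> //; try exact: e1.
move=> P B' i p fP sip; case: eB => eB1 eBS.
have [t tE] := factors_through_cover sip aB.
apply: IH (eBS _ _ _ _ fP sip).
- by have [] := fin_gen_ses nR sip fP.1.
- by exists P, i, t; split=> //; case: fP.
move=> g; have [h hE] := eB1 _ _ _ _ sip g.
have [w wE] := fP.2 _ _ q h qs.
by exists (w \o i) => b; rewrite /= wE hE.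
Qed.

(* Ext^i(X, N) = 0 for 0 <= i < k. *)
Definition Ext_zero_below k X N : Prop :=
  if k is k'.+1 then (forall (f : {linear X -> N}) x, f x = 0) /\ Ext_zero k' X N
  else True.

Lemma Ext_zero_below_le k l X N :
  (k <= l)%N -> Ext_zero_below l X N -> Ext_zero_below k X N.
Proof.
by case: k l => [//|k] [//|l] kl [h e]; split=> //; apply: Ext_zero_le e.
Qed.

Lemma Ext_zero_below_regular k a X N N' (q : {linear N -> N'}) :
  fin_gen X -> quotient_by a q -> (forall x : X, a *: x = 0) ->
  Ext_zero_below k X N' -> Ext_zero_below k.+1 X N.
Proof.
move=> fX qN aX eX; have [a0 _ _] := qN; split=> [f x|].
  by apply: a0; rewrite -linearZ aX linear0.
case: k eX => // k [h e]; apply: (Ext_zero_regular fX qN) => // [|g].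
  exists ('rV[R]_0 : lmodType R), \0, \0; split=> [|x].
    by case: (fg_projective_rV R 0).
  by rewrite aX.
by exists \0 => b; rewrite h linear0.
Qed.

Fixpoint regular_on (s : seq R) N : Prop :=
  if s is a :: s' then
    exists N' (q : {linear N -> N'}), quotient_by a q /\ regular_on s' N'
  else True.

Lemma regular_on_Ext_zero s X N : fin_gen X -> regular_on s N ->
  (forall a, a \in s -> forall x : X, a *: x = 0) -> Ext_zero_below (size s) X N.
Proof.
move=> fX; elim: s N => // a s IH N [N' [q [qN rs]]] sX.
apply: (Ext_zero_below_regular fX qN (sX a (mem_head a s))).
by apply: IH rs _ => b bs; apply: sX; rewrite inE bs orbT.
Qed.

Lemma in_span_rcons M (s : seq M) y x :
  in_span (rcons s y) x <-> exists c, in_span s (x - c *: y).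
Proof.
have [r0 rD rZ] := in_span_submodule (rcons s y).
have [s0 sD sZ] := in_span_submodule s.
split=> [xs|[c]].
  apply: (@in_spanW _ _ _ (fun x => exists c, in_span s (x - c *: y)) _ _ _ xs)
    => [|z].
    split=> [|u v [c cu] [d dv]|a u [c cu]].
    - by exists 0; rewrite scale0r subr0.
    - by exists (c + d); rewrite scalerDl opprD addrACA; apply: sD.
    - by exists (a * c); rewrite -scalerA -scalerBr; apply: sZ.
  rewrite mem_rcons inE => /orP[/eqP ->|zs]; first by exists 1; rewrite scale1r subrr.
  by exists 0; rewrite scale0r subr0; apply: in_span_mem.
move=> xs; rewrite -[x](subrK (c *: y)); apply: rD; last first.
  by apply/rZ/in_span_mem; rewrite mem_rcons mem_head.
apply: in_spanW xs => [|z zs]; first exact: in_span_submodule.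
by apply: in_span_mem; rewrite mem_rcons inE zs orbT.
Qed.

(** The stage reached after t is R modulo the span of t, represented by any surjection from R with
    that kernel. *)
Lemma regular_seq_on (s : seq R^o) : regular_seq s -> regular_on s RR.
Proof.
move=> [reg _]; suff gen t u N (q : {linear RR -> N}) : s = t ++ u ->
    surjective q -> (forall x, q x = 0 <-> in_span t x) -> regular_on u N.
  apply: (@gen [::] s RR idfun) => // [x|x]; first by exists x.
  split=> [/= ->|[a ->]]; last by rewrite big_ord0.
  by exists (fun=> 0); rewrite big_ord0.
elim: u t N q => // a u IH t N q sE qs qe.
have ss : (size t < size s)%N by rewrite sE size_cat addnS ltnS leq_addr.
have sa : s`_(size t) = a by rewrite sE nth_cat ltnn subnn.
have tt : take (size t) s = t by rewrite sE take_size_cat.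
have regt b : in_span t (a * b) -> in_span t b.
  by move=> tb; have := reg _ ss b; rewrite sa tt; apply.
have [N' [q' [qs' qe']]] := cokernel_ex ( *:%R a : {linear N -> N}).
exists N', q'; split; first split=> // x.
  have [b <-] := qs x; rewrite -linearZ => /qe tb.
  by apply/qe/regt.
apply: (IH (rcons t a) _ (q' \o q)) => [|x|x].
- by rewrite cat_rcons.
- by have [y <-] := qs' x; have [z <-] := qs y; exists z.
have qZ c : q (c *: (a : RR)) = a *: q c.
  by rewrite -linearZ; congr (q _); apply: mulrC.
rewrite in_span_rcons qe'; split=> [[y yE]|[c /qe]].
  have [c cE] := qs y; exists c; apply/qe.
  by rewrite linearB qZ cE -yE subrr.
rewrite linearB qZ => /eqP; rewrite subr_eq0 => /eqP ->.
by exists (q c).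
Qed.

(** A map X -> K lifts to F, because Ext^1(X, K') = 0, and there is no nonzero map from X to the
    projective F. *)
Lemma Hom_zero_resolvable q X K : fin_gen X -> pdim_lt q K ->
  Ext_zero_below q X RR -> forall (f : {linear X -> K}) x, f x = 0.
Proof.
move=> fX; case: q => [|q] rK.
  by move=> _ f x; rewrite [LHS]rK.
move=> [h0 eX] f x; have [F [K' [i [p [fF sip rK']]]]] := rK.
have eK' : Ext_zero 1 X K'.
  by apply: (Ext_zero_resolvable nR fX rK'); rewrite addn0.
have [w wE] := Ext1_zero_lift f sip (Ext_zero1 eK').
rewrite -wE (_ : w x = 0) ?linear0 //; apply: (projective_torsionless fF) => h.
exact: (h0 ((h : {linear F -> RR}) \o w)).
Qed.

(** A regular sequence of length at least q killing x would give Ext^i(R x, R) = 0 for i < q, and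
    then the inclusion of R x in K would be zero. *)
Lemma regular_seq_size q K (x : K) (s : seq R^o) : pdim_lt q K -> x <> 0 ->
  (forall a, a \in s -> a *: x = 0) -> regular_seq s -> (size s < q)%N.
Proof.
move=> rK x0 sx /regular_seq_on rs; rewrite ltnNge; apply/negP => qs.
have [X [k [ik kE]]] := submodule_ex (in_span_submodule [:: x]).
have kx y : exists c, k y = c *: x.
  have /(kE (k y))[a ->] : exists z, k z = k y by exists y.
  by exists (a 0%N); rewrite big_ord1.
have /kE[y yE] : in_span [:: x] x by apply: in_span_mem; rewrite inE.
have fX : fin_gen X.
  apply: (fin_gen_sub_cyclic (d := k) (y := x)) => // z; exact: kx.
apply: x0; rewrite -yE; apply: (Hom_zero_resolvable fX rK).
apply: (Ext_zero_below_le qs); apply: regular_on_Ext_zero => // a /sx ax z.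
apply: ik; have [c cE] := kx z; rewrite linear0 linearZ /= cE.
by rewrite scalerA mulrC -scalerA ax scaler0.
Qed.

End Depth.

(** * Finite Gorenstein dimension over a local ring *)

Section SocleElement.
Variable R : comPzRingType.
Implicit Types A B C F G K M N P Q S T U V W X Y Z : lmodType R.
Local Notation RR := (R^o : lmodType R).
Local Notation pdim_lt := (resolvable (@fg_projective R)).
Hypothesis nR : noetherian R.

(** * Vanishing of Tor against a module of finite projective dimension *)

Section Tor.
Variables (K : lmodType R) (L : resolution (@fg_projective R) K).

(* Tor_(i+1)(K, Y) = 0, with L (x) Y written as Hom(L^*, Y). *)
Definition Tor_zero i Y := forall y : {linear dual (L i.+1) -> Y},
  (forall h, y (dual_map (res_map L i) h) = 0) ->
  exists w : {linear dual (L i.+2) -> Y},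
    forall h, w (dual_map (res_map L i.+1) h) = y h.

(** Coordinates on P reduce to coefficients in R, where maps out of the dual of L are elements of L
    and exactness of L applies. *)
Lemma Tor_zero_projective i P : fg_projective P -> Tor_zero i P.
Proof.
move=> /fg_projectiveP[I [e [p ep]]] y y0.
have /choice[w wE] j : exists w : {linear dual (L i.+2) -> R^o},
    forall h, w (dual_map (res_map L i.+1) h) = dual_fun (p j) (y h).
  have [l lE] := projective_bidual (res_class L i.+1) ((p j : {linear P -> RR}) \o y).
  have /res_exactS[l' l'E] : res_map L i l = 0.
    apply: (projective_torsionless (res_class L i)) => h.
    by rewrite -dual_map_linE -lE /= y0 linear0.
  have [w wE] := eval_ex l'; exists w => h.
  by rewrite wE dual_map_linE l'E -lE.
have [v vE] : exists v : {linear dual (L i.+2) -> P},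
    forall h, v h = \sum_j w j h *: e j.
  apply: linear_ex => c x z; rewrite scaler_sumr -big_split /=.
  by apply: eq_bigr => j _; rewrite linearP scalerDl scalerA.
by exists v => h; rewrite vE [RHS]ep; apply: eq_bigr => j _; rewrite wE.
Qed.

Lemma dual_map_res i h :
  dual_map (res_map L i.+1) (dual_map (res_map L i) h) = 0.
Proof.
apply/dual_map0P => x; rewrite dual_map_linE.
by rewrite (_ : res_map L i _ = 0) /dual_fun ?linear0 //; apply/res_exactS; exists x.
Qed.

(** The connecting map: a cycle in Y' bounds some u in P, and p u is a cycle in Y one degree up. A
    map bounding p u corrects u to take values in Y'. *)
Lemma Tor_zero_syz i Y P Y' (j : {linear Y' -> P}) (p : {linear P -> Y}) :
  fg_projective P -> ses j p -> Tor_zero i.+1 Y -> Tor_zero i Y'.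
Proof.
move=> fP sjp tY y y0; have [ij ej ps] := sjp.
have [h|u uE] := Tor_zero_projective (i := i) fP (y := j \o y).
  by rewrite /= y0 linear0.
have [h|w wE] := tY (p \o u).
  by rewrite /= uE /= (ses0 sjp).
have [_ pL] := fg_projective_dual (res_class L i.+3).
have [w' w'E] := pL _ _ p w ps.
have [h|v vE] := factor_inj ij (f := u \- (w' \o dual_map (res_map L i.+2))).
  by apply/ej; rewrite linearB w'E wE subrr.
exists v => h; apply: ij.
by rewrite vE /= uE dual_map_res linear0 subr0.
Qed.

Lemma Tor_zero_iterated_syz q i n M Z :
  (forall k, (q <= k)%N -> forall x : L k, x = 0) -> (q <= i + n.+1)%N ->
  syz n M Z -> Tor_zero i Z.
Proof.
move=> L0; elim: n i Z => [|n IH] i Z qi.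
  move=> _ y y0; exists \0 => h; rewrite (_ : h = 0) ?linear0 //.
  apply: dual_ext => x; rewrite (L0 _ _ x) /dual_fun ?linear0 //.
  by rewrite -addn1.
move=> [Y [P [j [p [fP sjp sY]]]]]; apply: (Tor_zero_syz fP sjp).
by apply: IH sY; rewrite addSnnS.
Qed.

End Tor.

Lemma transpose_map_ex Z F (f : {linear dual Z -> F}) :
  torsionless Z -> bidual_onto Z -> exists z : {linear dual F -> Z},
    forall g h, dual_fun g (f h) = dual_fun h (z g).
Proof.
move=> tZ oZ.
have [g|a x y x' y' e e' h|y e|z zE _] :=
    @linear_of_rel R (dual F) Z (fun g z => forall h, dual_fun g (f h) = dual_fun h z).
- have [z zE] := oZ ((g : {linear F -> RR}) \o f).
  by exists z => h; rewrite -zE.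
- rewrite -[LHS]/(a * dual_fun x (f h) + dual_fun x' (f h)) e e'.
  by rewrite /dual_fun linearP.
- by apply: tZ => h; rewrite -e.
- by exists z.
Qed.

(** f is a map from Ext^(j+1)(M, R), the cokernel of the dual of i, to K. As Z is reflexive and Ext
    of its dual vanishes, maps from the dual of Z to K are elements of the tensor product of Z and
    K. So f lies in Tor_1(Y, K) = Tor_(j+1)(M, K), which is zero for q <= j + 1. *)
Lemma dual_surjective_socle q K (x : K) j M Y Z P (i : {linear Z -> P})
    (p : {linear P -> Y}) :
  pdim_lt q K -> fg_projective P -> ses i p -> syz j M Y -> (q <= j.+1)%N ->
  fin_gen Z -> (forall k, tfree k Z) ->
  forall f : {linear dual Z -> K}, (forall h, f (dual_map i h) = 0) ->
  forall h, f h = 0.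
Proof.
move=> rK fP sip sY qj fZ tZ f f0; case: q => [|q] in rK qj *.
  by move=> h; rewrite [LHS]rK.
have [L L0] := resolvable_resolution rK; have [ii ei ps] := sip.
have [K1 [k [a [sk sa ea ka]]]] := res_tail_ex L.
have rK1 : pdim_lt q K1.
  by apply: (resolution_resolvable (F := tail sa ea)) => l ql; apply: L0.
have [tlZ oZ _] := tZ 2%N; have [_ _ eZ] := tZ q.+2.
have e1 : Ext_zero 1 (dual Z) K1.
  by apply: (Ext_zero_resolvable nR (fin_gen_dual nR fZ) rK1); rewrite addn0.
(* Lift f to [L 0]; the transpose [z] of the lift is a chain with values in Z that represents f. *)
have [f0' f0E] := Ext1_zero_lift f sk (Ext_zero1 e1).
have [z zE] := transpose_map_ex f0' tlZ oZ.
have [_ ek _] := sk; have [ik _ _] := sk.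
(* As f kills the image of the dual of i, the chain becomes a boundary in P; [p1] is a bounding
   chain. *)
have [h|u uE] := factor_inj ik (f := f0' \o dual_map i).
  by apply/ek; rewrite /= f0E.
have [_ pP'] := fg_projective_dual fP.
have [u1 u1E] := pP' _ _ a u sa.
have [p1 p1E] := transpose_map_ex u1 (projective_torsionless fP) (projective_bidual fP).
have p1d g : p1 (dual_map (res_map L 0) g) = i (z g).
  apply/eqP; rewrite -subr_eq0; apply/eqP/(projective_torsionless fP) => h.
  rewrite /dual_fun linearB -[X in X - _]/(dual_fun h _) -p1E dual_map_linE.
  rewrite -ka u1E uE zE dual_map_linE.
  by rewrite subrr.
(* [p \o p1] is the resulting cycle for Tor_1(K, Y). Since it bounds, [p1] can be corrected to take
   values in Z, so that [z] already bounds there. *)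
have [g|w wE] := @Tor_zero_iterated_syz K L q.+1 0 j M Y L0 qj sY (p \o p1).
  by rewrite /= p1d (ses0 sip).
have [_ pL] := fg_projective_dual (res_class L 2).
have [w' w'E] := pL _ _ p w ps.
have [g|v vE] := factor_inj ii (f := p1 \- (w' \o dual_map (res_map L 1))).
  by apply/ei; rewrite linearB w'E wE subrr.
have vd g : v (dual_map (res_map L 0) g) = z g.
  by apply: ii; rewrite vE /= dual_map_res linear0 subr0 p1d.
move=> h; rewrite -f0E.
have [l lE] := projective_bidual (res_class L 1) ((h : {linear Z -> RR}) \o v).
suff -> : f0' h = res_map L 0 l by apply/res_exact0; exists l.
apply/eqP; rewrite -subr_eq0; apply/eqP/(projective_torsionless (res_class L 0)) => g.
rewrite /dual_fun linearB -[X in X - _]/(dual_fun g _) zE.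
rewrite -[X in _ - X]/(dual_fun (dual_map (res_map L 0) g) l).
by rewrite -lE /= vd subrr.
Qed.

(** Take as few elements e as possible that generate V together with the image of f. In a relation
    their coefficients are then nonunits, which kill x. Hence, if there is any e, the first
    coefficient times x is a nonzero map V -> K vanishing on the image. *)
Lemma surjective_socle U V K (f : {linear U -> V}) (x : K) :
  fin_gen V -> x <> 0 -> (forall a : R, nonunit a -> a *: x = 0) ->
  (forall g : {linear V -> K}, (forall u, g (f u) = 0) -> forall v, g v = 0) ->
  surjective f.
Proof.
move=> [s sP] x0 xa fg.
pose Q m := `[< exists e : 'I_m -> V, forall v, exists u (a : 'I_m -> R),
  v = f u + \sum_i a i *: e i >].
have exQ : exists m, Q m.
  exists (size s); apply/asboolP; exists (fun i => s`_i) => v.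
  by have [a aE] := sP v; exists 0, (fun i => a i); rewrite linear0 add0r.
case: (ex_minnP exQ) => -[|m] /asboolP[e eP] minm.
  by move=> v; have [u [a ->]] := eP v; exists u; rewrite big_ord0 addr0.
pose r v k := exists u (a : 'I_m.+1 -> R),
  v = f u + \sum_i a i *: e i /\ k = a ord0 *: x.
have [v|c v k v' k' [u [a [-> ->]]] [u' [a' [-> ->]]]|k [u [a [v0 ->]]]|g _ gE] :=
    @linear_of_rel R V K r.
- by have [u [a aE]] := eP v; exists (a ord0 *: x), u, a.
- exists (c *: u + u'), (fun i => c * a i + a' i); split; last first.
    by rewrite scalerDl scalerA.
  rewrite linearP scalerDr addrACA scaler_sumr -big_split; congr (_ + _).
  by apply: eq_bigr => i _; rewrite scalerDl scalerA.
(* A unit coefficient would allow the first generator to be eliminated. *)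
- apply: xa => -[b ab]; suff /minm : Q m by rewrite ltnn.
  apply/asboolP; exists (fun i => e (lift ord0 i)) => v.
  have [u' [a' ->]] := eP v.
  pose c := a' ord0 * b.
  exists (u' - c *: u), (fun i => a' (lift ord0 i) - c * a (lift ord0 i)).
  have fB : f (u' - c *: u) = f u' - c *: f u by rewrite linearB linearZ.
  have e0 : c *: (f u + \sum_i a i *: e i) = 0 by rewrite -v0 scaler0.
  rewrite -[LHS]subr0 -[X in _ - X]e0 !big_ord_recl fB !scalerDr scalerA.
  have -> : c * a ord0 = a' ord0 by rewrite /c -mulrA [b * _]mulrC ab mulr1.
  have E (p q r1 t1 t2 : V) : (p + (q + r1)) - (t1 + (q + t2)) = p - t1 + (r1 - t2).
    by rewrite opprD addrACA opprD [q + r1 + _]addrACA subrr add0r.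
  rewrite E scaler_sumr -sumrB; congr (_ + _); apply: eq_bigr => i _.
  by rewrite scalerBl scalerA.
- case: x0; have re : r (e ord0) x.
    exists 0, (fun i => (i == ord0)%:R); rewrite eqxx scale1r linear0 add0r.
    split=> //; rewrite (bigD1 ord0) //= scale1r big1 ?addr0 // => i /negPf ->.
    exact: scale0r.
  rewrite -(gE _ _ re) fg // => u; apply: gE; exists u, (fun=> 0).
  by rewrite scale0r big1 ?addr0 // => i _; rewrite scale0r.
Qed.

(* The Auslander-Buchsbaum bound: the socle element x of K forces depth R < q,
   so Ext^(j+1)(M, R) = 0 for j + 1 >= q as soon as the (j+1)-st syzygy Z of M
   is totally reflexive. *)
Lemma extends_along_socle q K (x : K) j M Y Z P (i : {linear Z -> P})
    (p : {linear P -> Y}) :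
  pdim_lt q K -> x <> 0 -> (forall a : R, nonunit a -> a *: x = 0) ->
  fg_projective P -> ses i p -> syz j M Y -> (q <= j.+1)%N ->
  (forall k, tfree k Z) -> extends_along RR i.
Proof.
move=> rK x0 xa fP sip sY qj tZ.
have [fZ _] := fin_gen_ses nR sip fP.1.
have sd : surjective (dual_map i).
  apply: (surjective_socle (fin_gen_dual nR fZ) x0 xa).
  exact: (dual_surjective_socle x rK fP sip sY qj fZ tZ).
by move=> f; have [g gE] := sd f; exists g => z; rewrite -gE.
Qed.

(** * Totally reflexive modules *)

Definition totally_reflexive G :=
  [/\ fin_gen G, forall k, Ext_zero k G RR & forall k, tfree k G].

Lemma gorenstein_projective_totally_reflexive G :
  gorenstein_projective G -> totally_reflexive G.
Proof.
move=> [fG eG tG]; split=> // k.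
  by apply: (Ext_vanishes_zero nR fG) => i /andP[i0 _]; apply: eG.
by apply/(torsionfreeP nR k fG) => P i /andP[i0 _]; apply: tG.
Qed.

Lemma projective_totally_reflexive P : fg_projective P -> totally_reflexive P.
Proof.
move=> fP; split=> [|k|k]; [by case: fP | exact: Ext_zero_projective |].
have tP := projective_torsionless fP.
case: k => [|[|k]] //=; split=> //; first exact: projective_bidual.
exact/Ext_zero_projective/fg_projective_dual.
Qed.

(** The dual sequence is exact as Ext^1(C, R) = 0, and its dual is exact as C is reflexive, so the
    conditions on the duals pass to A too. *)
Lemma totally_reflexive_ker A B C (i : {linear A -> B}) (p : {linear B -> C}) :
  ses i p -> totally_reflexive B -> totally_reflexive C -> totally_reflexive A.
Proof.
move=> sip [fB eB tB] [fC eC tC]; have [ii _ ps] := sip.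
have [fA _] := fin_gen_ses nR sip fB.
have ei : extends_along RR i by apply: (Ext_zero1 (eC 1%N)) sip.
have [tlB oB _] := tB 2%N; have [tlC oC _] := tC 2%N.
split=> // k; first exact: (Ext_zero_ker nR sip fC (eB k) (eC k.+1)).
have tlA := torsionless_sub ii tlB.
case: k => [|[|k]] //=; split=> //; first exact: coker_bidual_onto sip ei oB tlC.
case: k => // k; have [_ _ eB'] := tB k.+3; have [_ _ eC'] := tC k.+2.
apply: (Ext_zero_coker nR (ses_dual sip ei) (fin_gen_dual nR fB) _ eC' eB').
exact: bidual_onto_extends.
Qed.

Lemma totally_reflexive_prod G P :
  totally_reflexive G -> fg_projective P -> totally_reflexive (G * P)%type.
Proof.
move=> [fG eG tG] fP; have [i sip] := ses_prod G P.
have [fP' eP _] := projective_totally_reflexive fP.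
have [tlG oG _] := tG 2%N; have tlP := projective_torsionless fP.
have ei : extends_along RR i by apply: (Ext_zero1 (eP 1%N)) sip.
have tl : torsionless (G * P)%type.
  move=> [g x] gx; congr pair.
    by apply: tlG => h; have := gx (dual_map fst h).
  by apply: tlP => h; have := gx (dual_map snd h).
split=> [|k|k]; first exact: fin_gen_ext sip fG fP'.
  exact: (Ext_zero_ext nR sip fG (eG k) (eP k)).
case: k => [|[|k]] //=; split=> //; last first.
  apply: (Ext_zero_ext nR (ses_dual sip ei)).
  - exact: fin_gen_dual.
  - exact/Ext_zero_projective/fg_projective_dual.
  - by have [_ _] := tG k.+2.
move=> f; have [g gE] := oG (f \o dual_map fst).
have [x xE] := projective_bidual fP (f \o dual_map snd).
have [jG jGE] := pair_ex (idfun : {linear G -> G}) (\0 : {linear G -> P}).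
have [jP jPE] := pair_ex (\0 : {linear P -> G}) (idfun : {linear P -> P}).
have dec (h : dual (G * P)%type) u v :
    dual_fun h (u, v) = dual_fun h (jG u) + dual_fun h (jP v).
  have -> : (u, v) = jG u + jP v :> (G * P)%type.
    by rewrite jGE jPE; congr pair; rewrite /= ?addr0 ?add0r.
  by rewrite /dual_fun linearD.
exists (g, x) => h.
have -> : h = dual_map fst (dual_map jG h) + dual_map snd (dual_map jP h).
  by apply: dual_ext => -[u v]; rewrite dec.
rewrite linearD.
have := gE (dual_map jG h); have := xE (dual_map jP h) => /= -> ->.
by [].
Qed.

(* S -> M' + X ->> B compares the t-th syzygies S and M' of M in a projective
   resolution and in a resolution by totally reflexive modules. *)
Lemma syz_tfree_aux m S M' X B U (k : {linear S -> (M' * X)%type})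
    (f : {linear (M' * X)%type -> B}) :
  ses k f -> fg_projective X -> totally_reflexive B ->
  resolvable totally_reflexive m M' -> syz m S U -> forall l, tfree l U.
Proof.
elim: m S M' X B k f => [|m IH] S M' X B k f skf fX tB rM' sU.
  (* Here M' = 0, so S embeds in a projective with totally reflexive cokernel B. *)
  rewrite sU; case=> // l; have [_ eB tB'] := tB.
  apply/(tfree_step nR l _ skf) => //; last exact: (Ext_zero1 (eB 1%N)) skf.
  by apply: fg_projective_prod fX; apply: fg_projective_0 rM'.
have [S' [P [j [q [fP sjq sU']]]]] := syz_head sU.
have [G [M'' [i' [p' [tG sip' rM'']]]]] := rM'.
have [ik ef fs] := skf; have [ij ejq qs] := sjq; have [ii' ep' ps'] := sip'.
have [c cE] := pair_ex (p' \o fst : {linear (G * X)%type -> M'}) snd.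
have cs : surjective c.
  by move=> [m' x]; have [g gE] := ps' m'; exists (g, x); rewrite cE /= gE.
have Fs : surjective (f \o c).
  by move=> b; have [y <-] := fs b; have [z <-] := cs y; exists z.
have [B' [b sb]] := ses_ker Fs; have [ib eb _] := sb.
have tB' := totally_reflexive_ker sb (totally_reflexive_prod tG fX) tB.
(* [l] lifts P -> S -> M' + X to G + X. The next comparison is M'' + P ->> B', and its kernel is S',
   embedded by - nu and j. *)
have [l lE] := fP.2 _ _ c (k \o q) cs.
have [y|l' l'E] := factor_inj ib (f := l).
  by apply/eb; rewrite /= lE /= (ses0 skf).
have [m0 m0E] := pair_ex i' (\0 : {linear M'' -> X}).
have cm0 y : c (m0 y) = 0 by rewrite cE m0E /= (ses0 sip').
have [y|mu muE] := factor_inj ib (f := m0).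
  by apply/eb; rewrite /= cm0 linear0.
have cker z : c z = 0 -> exists y, m0 y = z.
  case: z => g x; rewrite cE => -[/ep'[y yE] /= x0].
  by exists y; rewrite m0E /= yE x0.
have im0 : injective m0 by apply: inj0P => y; rewrite m0E => -[/(inj0 ii')].
have [y|nu nuE] := factor_inj im0 (f := l \o j).
  by apply: cker; rewrite /= lE /= (ses0 sjq) linear0.
have [sg sgE] := pair_ex (\- nu) j.
have ss : ses sg (copair mu l').
  split=> [|[y x]|z].
  - by apply: inj0P => y; rewrite sgE => -[_ /(inj0 ij)].
  - rewrite /copair /=; split=> [e|[s]]; last first.
      rewrite sgE => -[<- <-]; apply: ib.
      by rewrite linearD muE l'E /= linearN nuE addNr linear0.
    have e' : m0 y + l x = 0 by rewrite -muE -l'E -linearD e linear0.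
    have : c (m0 y + l x) = 0 by rewrite e' linear0.
    rewrite linearD cm0 add0r lE => /(inj0 ik)/ejq[s sE].
    exists s; rewrite sgE sE; congr pair; apply: im0.
    rewrite linearN nuE /= sE; apply/eqP.
    by rewrite eq_sym -addr_eq0 e'.
  - have /ef[s sE] : f (c (b z)) = 0 := ses0 sb z.
    have [x xE] := qs s.
    have [|y yE] := cker (b z - l x).
      by rewrite linearB lE /= xE sE subrr.
    by exists (y, x); apply: ib; rewrite /copair /= linearD muE l'E yE subrK.
exact: IH ss fP tB' rM'' sU'.
Qed.

Lemma syz_tfree m M U : resolvable totally_reflexive m M -> syz m M U ->
  forall l, tfree l U.
Proof.
move=> rM; have P0 (x : 'rV[R]_0) : x = 0 by apply/rowP => -[].
have fP := fg_projective_rV R 0.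
have [i iE] := pair_ex (idfun : {linear M -> M}) (\0 : {linear M -> 'rV[R]_0}).
apply: (syz_tfree_aux (k := i) (f := \0 : {linear _ -> 'rV[R]_0}) _ fP _ rM).
  split=> [|[y x]|x]; last by exists 0; rewrite [RHS]P0.
    by apply: inj0P => y; rewrite iE => -[].
  by split=> // _; exists y; rewrite iE [x]P0.
exact: projective_totally_reflexive.
Qed.

(** Syzygies beyond g are torsionfree of every order. [extends_along_socle] and [tfree_step] carry
    this down one syzygy at a time as far as the n-th. *)
Lemma finite_gorenstein_dim_tfree q K (x : K) n M Z :
  pdim_lt q K -> x <> 0 -> (forall a : R, nonunit a -> a *: x = 0) ->
  (q <= n)%N -> fin_gen M -> finite_gorenstein_dim M -> syz n M Z ->
  forall l, tfree l Z.
Proof.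
move=> rK x0 xa qn fM [g [F F0]].
have rM m : (g < m)%N -> resolvable totally_reflexive m M.
  move=> gm.
  have rM : resolvable (@gorenstein_projective R) m M.
    by apply: (resolution_resolvable (F := F)) => k mk; apply: F0; apply: leq_trans mk.
  elim: (m) M rM {fM F F0} => // m' IH M [P [M' [i [p [gP sip /IH rM]]]]].
  by exists P, M', i, p; split=> //; apply: gorenstein_projective_totally_reflexive.
(* r bounds how far j falls short of exceeding g. *)
suff gen r j Y : (n <= j)%N -> (g < j + r)%N -> fin_gen Y -> syz j M Y ->
    forall l, tfree l Y.
  move=> sZ; apply: (gen g.+1 n) => //; first by rewrite addnS ltnS leq_addl.
  elim: (n) (Z) sZ => [_ -> //|n' _ Z' [N [P [i [p [fP sip _]]]]]].
  by have [] := fin_gen_ses nR sip fP.1.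
elim: r j Y => [|r IH] j Y nj gj fY sY.
  by apply: syz_tfree sY; apply: rM; rewrite -(addn0 j).
have [P [Y' [i [p [fP sip]]]]] := projective_cover fY.
have tY' : forall l, tfree l Y'.
  apply: (IH j.+1); rewrite ?addSnnS //; first exact: leqW.
    by have [] := fin_gen_ses nR sip fP.1.
  by exists Y, P, i, p.
have ei : extends_along RR i.
  apply: (extends_along_socle rK x0 xa fP sip sY) => //.
  exact: leq_trans qn (leqW nj).
by move=> l; apply/(tfree_step nR l fP sip ei).
Qed.

End SocleElement.

(** * Localization *)

Section Localization.
Variables (R : comPzRingType) (p : prime_ideal R).
Implicit Types A B C F G K M N P Q S T U V W X Y Z : lmodType R.
Local Notation RR := (R^o : lmodType R).
Local Notation A := (loc_ring p).
Local Notation L M := (localize p M : lmodType A).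
Local Notation "m // s" := (lfrac (p := p) m s) (at level 40).
Local Notation one := (denom1 p).

Definition loc_scalar (r : R) : A := (r : RR) // one.

Lemma fracZ M (r : RR) s (m : M) t :
  (r // s : A) *: (m // t : L M) = (r *: m) // (denomM s t).
Proof. exact: loc_scaleE. Qed.

Lemma frac_eq0 M (m : M) s : (m // s = 0 :> L M) <-> exists u : denom p, dval u *: m = 0.
Proof.
rewrite -[0 : (L M)]/(0 // one) fracP; split=> [[u]|[u uE]].
  by rewrite dval1 mulr1 scaler0; exists u.
by exists u; rewrite dval1 mulr1 scaler0.
Qed.

Lemma frac0 M s : (0 : M) // s = 0 :> L M.
Proof. by apply/frac_eq0; exists one; rewrite scaler0. Qed.

Lemma loc_scalarZ M r (m : M) s : loc_scalar r *: (m // s : L M) = (r *: m) // s.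
Proof. by rewrite fracZ; apply: frac_eq; rewrite dvalM dval1 mul1r. Qed.

Lemma frac_add1 M (m n : M) s : (m + n) // s = (m // s + n // s : L M).
Proof.
rewrite fracD; apply: frac_eq; rewrite dvalM -scalerDr !scalerA.
by congr (_ *: _); ring.
Qed.

Definition loc_inv (s : denom p) : A := (1 : RR) // s.

Lemma loc_invK s : loc_inv s * loc_scalar (dval s) = 1.
Proof.
rewrite -[LHS]/(loc_scale _ _) loc_scaleE; apply: frac_eq.
by rewrite dvalM !dval1 /GRing.scale /=; ring.
Qed.

Lemma frac_inv M (m : M) s : m // s = loc_inv s *: (m // one : L M).
Proof. by rewrite fracZ; apply: frac_eq; rewrite dvalM dval1 mulr1 scale1r. Qed.

Lemma loc_scalarK M s (x : L M) : loc_inv s *: (loc_scalar (dval s) *: x) = x.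
Proof. by rewrite scalerA loc_invK scale1r. Qed.

Lemma loc_scalarM r r' : loc_scalar (r * r') = loc_scalar r * loc_scalar r'.
Proof.
rewrite -[RHS]/(loc_scale _ _) loc_scaleE; apply: frac_eq.
by rewrite dvalM !dval1 /GRing.scale /=; ring.
Qed.

Lemma loc_map_ex U V (f : {linear U -> V}) :
  exists g : {linear L U -> L V}, forall u s, g (u // s) = f u // s.
Proof.
have fZ a u : f (a *: u) = a *: f u by rewrite linearZ.
have [x|a x y x' y' [u [s [-> ->]]] [u' [s' [-> ->]]]|y [u [s [e ->]]]|g _ gE] :=
  @linear_of_rel A (L U) (L V) (fun x y => exists u s, x = u // s /\ y = f u // s).
- by elim/fracW: x => u s; exists (f u // s), u, s.
- elim/fracW: a => r t; rewrite !fracZ !fracD.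
  exists (dval s' *: (r *: u) + dval (denomM t s) *: u'), (denomM (denomM t s) s').
  by split=> //; rewrite linearD !fZ.
- have /esym/frac_eq0[v vu] := e; apply/frac_eq0; exists v.
  by rewrite -fZ vu linear0.
by exists g => u s; apply: gE; exists u, s.
Qed.

Definition localizes U V (f : {linear U -> V}) (g : {linear L U -> L V}) :=
  forall u s, g (u // s) = f u // s.

Lemma ses_localize U V W (i : {linear U -> V}) (q : {linear V -> W}) j r :
  localizes i j -> localizes q r -> ses i q -> ses j r.
Proof.
move=> ij qr siq; have [ii eq qs] := siq; split.
- apply: inj0P; elim/fracW => u s; rewrite ij => /frac_eq0[t].
  by rewrite -linearZ => /(inj0 ii) tu; apply/frac_eq0; exists t.
- elim/fracW => v s; rewrite qr; split=> [/frac_eq0[t]|[]].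
    rewrite -linearZ => /eq[u uE]; exists (u // denomM t s).
    by rewrite ij uE; apply: frac_eq; rewrite dvalM scalerA mulrC.
  elim/fracW => u t; rewrite ij => e.
  have : r (i u // t) = 0 by rewrite qr (ses0 siq) frac0.
  by rewrite e qr.
- by elim/fracW => w s; have [v <-] := qs w; exists (v // s); rewrite qr.
Qed.

Lemma ses_localize_ex U V W (i : {linear U -> V}) (q : {linear V -> W}) :
  ses i q -> exists (j : {linear L U -> L V}) (r : {linear L V -> L W}),
    [/\ localizes i j, localizes q r & ses j r].
Proof.
move=> siq; have [j jE] := loc_map_ex i; have [r rE] := loc_map_ex q.
by exists j, r; split=> //; apply: (ses_localize jE rE siq).
Qed.

Lemma frac_sum M (I : Type) (l : seq I) (F : I -> M) s :
  (\sum_(i <- l) F i) // s = \sum_(i <- l) (F i // s : L M).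
Proof.
elim: l => [|i l IH]; first by rewrite !big_nil frac0.
by rewrite !big_cons frac_add1 IH.
Qed.

Lemma loc_dual_ex M (h : dual M) :
  exists g : dual (L M), forall m s, dual_fun g (m // s) = (dual_fun h m : RR) // s.
Proof.
have [g gE] := loc_map_ex (h : {linear M -> RR}).
have [k kE] : exists k : {linear L M -> A^o}, forall x, k x = g x.
  by apply: linear_ex => a x y; rewrite linearP.
by exists k => m s; rewrite /dual_fun kE gE.
Qed.

Lemma fg_projective_localize P : fg_projective P -> fg_projective (L P).
Proof.
move=> /fg_projectiveP[I [e [h eh]]]; apply/fg_projectiveP.
have /choice[g gE] i := loc_dual_ex (h i).
exists I, (fun i => e i // one), g; elim/fracW => x s.
rewrite {1}[x]eh frac_sum; apply: eq_bigr => i _.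
by rewrite gE fracZ; apply: frac_eq; rewrite dvalM dval1 mulr1.
Qed.

Lemma fin_gen_localize M : fin_gen M -> fin_gen (L M).
Proof.
move=> fM; have [P [K [i [q [fP siq]]]]] := projective_cover fM.
have [j [r [_ _ [_ _ rs]]]] := ses_localize_ex siq.
by apply: (fin_gen_surj rs); case: (fg_projective_localize fP).
Qed.

Lemma noetherian_localize : noetherian R -> noetherian A.
Proof.
move=> nR I [I0 ID IZ].
have [|s sP] := nR (fun r : R^o => I (loc_scalar r)).
  split=> [|a b Ia Ib|a b Ib].
  - by rewrite (_ : loc_scalar 0 = 0) //; apply: frac0.
  - rewrite (_ : loc_scalar _ = loc_scalar a + loc_scalar b); first exact: ID.
    exact: frac_add1.
  - rewrite -[a *: b]/(a * b) loc_scalarM; exact: IZ.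
exists [seq loc_scalar r | r <- s] => x; split=> [|]; last first.
  apply: in_spanW => // _ /mapP[r rs ->]; apply/sP.
  exact: in_span_mem.
elim/fracW: x => r t Ir.
have /sP[a aE] : I (loc_scalar r).
  rewrite (_ : loc_scalar r = loc_scalar (dval t) *: (r // t : A^o)).
    exact: IZ.
  rewrite -[RHS]/(loc_scale _ _) loc_scaleE; apply: frac_eq.
  by rewrite dvalM !dval1 /GRing.scale /=; ring.
exists (fun i => (a i : RR) // t); rewrite aE frac_sum size_map.
apply: eq_bigr => i _; rewrite (nth_map 0) //.
rewrite -[RHS]/(loc_scale _ _) loc_scaleE; apply: frac_eq.
by rewrite dvalM dval1 mulr1.
Qed.

Lemma resolvable_localize n M :
  resolvable (@fg_projective R) n M -> resolvable (@fg_projective A) n (L M).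
Proof.
elim: n M => [|n IH] M /= rM.
  by elim/fracW => m s; rewrite [m]rM frac0.
have [P [M' [i [q [fP siq /IH rM']]]]] := rM.
have [j [r [_ _ sjr]]] := ses_localize_ex siq.
by exists (L P), (L M'), j, r; split=> //; apply: fg_projective_localize.
Qed.

Lemma syz_localize n M Z : syz n M Z -> syz n (L M) (L Z).
Proof.
elim: n Z => [_ -> //|n IH] Z [N [P [i [q [fP siq /IH sN]]]]].
have [j [r [_ _ sjr]]] := ses_localize_ex siq.
by exists (L N), (L P), j, r; split=> //; apply: fg_projective_localize.
Qed.

Lemma common_denom M (l : seq (L M)) :
  exists t : denom p, forall x, x \in l ->
    exists m, loc_scalar (dval t) *: x = m // one.
Proof.
elim: l => [|y l [t tE]]; first by exists one.
elim/fracW: y => m s; exists (denomM s t) => x; rewrite inE => /orP[/eqP ->|/tE[n nE]].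
  exists (dval t *: m); rewrite loc_scalarZ; apply: frac_eq.
  by rewrite dvalM dval1 scale1r scalerA.
by exists (dval s *: n); rewrite dvalM loc_scalarM -scalerA nE loc_scalarZ.
Qed.

Lemma common_annihilator M (l : seq M) :
  (forall m, m \in l -> m // one = 0 :> L M) ->
  exists t : denom p, forall m, m \in l -> dval t *: m = 0.
Proof.
elim: l => [|y l IH] l0; first by exists one.
have [m ml|t tE] := IH; first by apply: l0; rewrite inE ml orbT.
have /frac_eq0[s sE] := l0 y (mem_head y l).
exists (denomM s t) => m; rewrite inE dvalM => /orP[/eqP ->|/tE mE].
  by rewrite mulrC -scalerA sE scaler0.
by rewrite -scalerA mE scaler0.
Qed.

(** Clear the denominators of f on generators of a cover P. The relations K are finitely generated,
    so one further denominator u makes the functional vanish on them and descend to Z. *)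
Lemma dual_localize Z (f : {linear L Z -> A^o}) : noetherian R -> fin_gen Z ->
  exists (t : denom p) (g : dual Z),
    forall z, loc_scalar (dval t) *: f (z // one) = loc_scalar (dual_fun g z) :> A^o.
Proof.
move=> nR fZ; have [P [K [i [q [fP siq]]]]] := projective_cover fZ.
have [[s sP] _] := fin_gen_ses nR siq fP.1.
have /fg_projectiveP[I [e [h eh]]] := fP; have [_ eq qs] := siq.
have [t tE] := @common_denom RR (codom (fun i => f (q (e i) // one) : L RR)).
have /choice[r rE] j : exists r : RR,
    loc_scalar (dval t) *: (f (q (e j) // one) : L RR) = r // one.
  by apply: tE; apply: codom_f.
have [F FE] : exists F : {linear P -> RR}, forall x, F x = \sum_j dual_fun (h j) x *: r j.
  apply: linear_ex => a x y; rewrite scaler_sumr -big_split /=.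
  by apply: eq_bigr => j _; rewrite /dual_fun linearP scalerDl scalerA.
have Ff x : loc_scalar (F x) = loc_scalar (dval t) *: f (q x // one).
  have qx : q x // one = \sum_j loc_scalar (dual_fun (h j) x) *: (q (e j) // one : L Z).
    rewrite {1}[x]eh linear_sum frac_sum; apply: eq_bigr => j _.
    by rewrite linearZ loc_scalarZ.
  rewrite FE qx linear_sum scaler_sumr /loc_scalar frac_sum.
  apply: eq_bigr => j _; rewrite linearZ /= -loc_scalarZ -rE.
  by rewrite ![_ *: (_ *: _)]scalerA mulrC.
have [|u uE] := @common_annihilator RR [seq F (i k) | k <- s].
  move=> _ /mapP[k ks ->]; rewrite -[LHS]/(loc_scalar _) Ff (ses0 siq) frac0.
  by rewrite linear0 scaler0.
have [_ /eq[k <-]|g gE] := factor_surj qs (f := dval u \*: F).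
  have [a ->] := sP k; rewrite linear_sum linear_sum big1 // => j _.
  rewrite !linearZ /= linearZ /= scalerA mulrC -scalerA uE ?scaler0 //.
  by apply: map_f; apply: mem_nth.
exists (denomM u t), g => z; have [x <-] := qs z.
rewrite dvalM loc_scalarM -scalerA -Ff [dual_fun _ _]gE.
exact/esym/loc_scalarM.
Qed.

Lemma extends_along_localize Z Q (i : {linear Z -> Q}) (j : {linear L Z -> L Q}) :
  noetherian R -> fin_gen Z -> localizes i j ->
  extends_along RR i -> extends_along (A^o : lmodType A) j.
Proof.
move=> nR fZ ij ei f; have [t [g gE]] := dual_localize f nR fZ.
have [h hE] := ei g; have [k kE] := loc_dual_ex h.
exists (loc_inv t \*: (k : {linear L Q -> A^o})); elim/fracW => z s.
have hz : dual_fun h (i z) = dual_fun g z := hE z.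
have kz : k (i z // one) = loc_scalar (dual_fun g z) by rewrite -hz; apply: kE.
rewrite /= ij (frac_inv (i z)) (frac_inv z) !linearZ /= kz -gE.
by congr (_ *: _); apply: loc_scalarK.
Qed.

Lemma torsion_localize Z (z : Z) : noetherian R -> fin_gen Z ->
  (forall h : dual Z, dual_fun h z = 0) -> torsionless (L Z) -> z // one = 0 :> L Z.
Proof.
move=> nR fZ z0 tZ; apply: tZ => f; have [t [g gE]] := dual_localize f nR fZ.
rewrite -[LHS](scale1r (_ : A^o)) -(loc_invK t) -scalerA [X in _ *: X]gE z0.
by rewrite (_ : loc_scalar 0 = 0) ?scaler0 //; apply: frac0.
Qed.

End Localization.

(** * The converse *)

Section Converse.
Variable R : comPzRingType.
Implicit Types A B C F G K M N P Q S T U V W X Y Z : lmodType R.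
Local Notation RR := (R^o : lmodType R).
Hypothesis nR : noetherian R.

(** If no annihilator of a nonzero multiple of x were prime, each could be strictly enlarged, giving
    an infinite ascending chain of ideals. *)
Lemma associated_prime K (x : K) : x <> 0 ->
  exists (p : prime_ideal R) (r : R), forall a : R, p a <-> a *: (r *: x) = 0.
Proof.
move=> x0; pose ann r (a : R^o) := a *: (r *: x) = 0.
have annS r : is_submodule (ann r).
  split=> [|a b ar br|a b br]; first exact: scale0r.
    by rewrite /ann scalerDl ar br addr0.
  by rewrite /ann -[a *: b]/(a * b) -scalerA br scaler0.
apply: contrapT => np.
have [r|f fP] := @choice R R (fun r s => r *: x <> 0 ->
    [/\ s *: x <> 0, forall a, ann r a -> ann s a & exists2 a, ann s a & ~ ann r a]).
  have [rx|rx] := pselect (r *: x = 0); first by exists r.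
  have n1 : ~ ann r 1 by rewrite /ann scale1r.
  apply: contrapT => ns; apply: np.
  have rM a b : ann r (a * b) -> ann r a \/ ann r b.
    move=> rab; have [|nb] := pselect (ann r b); first by right.
    (* If a b kills r x but neither a nor b does, then b r x is nonzero and a is new in its
       annihilator. *)
    left; apply: contrapT => na; apply: ns; exists (b * r) => _.
    split=> [|c cr|]; first by rewrite -scalerA.
      have -> : ann (b * r) c = (b *: (c *: (r *: x)) = 0).
        by rewrite /ann !scalerA; congr (_ *: _ = _); ring.
      by rewrite [c *: _]cr scaler0.
    by exists a => //; move: rab; rewrite /ann !scalerA mulrA.
  by exists (PrimeIdeal (annS r) n1 rM), r.
pose r k := iter k f 1.
have r0 k : r k *: x <> 0.
  by elim: k => [|k /fP[]] //=; rewrite scale1r.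
have rle k l a : (k <= l)%N -> ann (r k) a -> ann (r l) a.
  move/subnK <-; elim: (l - k)%N => // m IH /IH.
  by have [_ + _] := fP _ (r0 (m + k)%N); apply.
have [|s sP] := @nR (fun a => exists k, ann (r k) a).
  split=> [|a b [k ka] [l lb]|a b [k kb]].
  - by exists 0%N; have [] := annS (r 0).
  - exists (maxn k l); have [_ + _] := annS (r (maxn k l)); apply.
      exact: rle (leq_maxl k l) ka.
    exact: rle (leq_maxr k l) lb.
  - by exists k; have [_ _] := annS (r k); apply.
have [m sm] : exists m : nat, forall a, a \in s -> ann (r m) a.
  have : forall a, a \in s -> exists k, ann (r k) a.
    by move=> a /in_span_mem/sP.
  elim: (s) => [|b t IH] ts; first by exists 0%N.
  have [|l tl] := IH; first by move=> a at_; apply: ts; rewrite inE at_ orbT.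
  have [k kb] := ts b (mem_head b t); exists (maxn k l) => a.
  rewrite inE => /orP[/eqP ->|/tl]; [exact: rle (leq_maxl k l) kb|].
  exact: rle (leq_maxr k l).
have [_ _ [a aS]] := fP _ (r0 m); apply.
have /sP : exists k, ann (r k) a by exists m.+1.
exact: (in_spanW (annS (r m))).
Qed.

(** Regular sequences of nonunits have length less than q, so a longest one exists and its length is
    the depth. *)
Lemma depth_lt q K (x : K) : resolvable (@fg_projective R) q K -> x <> 0 ->
  (forall a : R, nonunit a -> a *: x = 0) -> exists2 d, depth_eq R d & (d < q)%N.
Proof.
move=> rK x0 xa.
pose reg d := `[< exists2 s : seq R^o,
  regular_seq s /\ (forall a, a \in s -> nonunit a) & size s = d >].
have ub (s : seq R^o) :
    regular_seq s /\ (forall a, a \in s -> nonunit a) -> (size s < q)%N.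
  by move=> [rs sn]; apply: (regular_seq_size nR rK x0 _ rs) => a /sn/xa.
have reg0 : reg 0%N.
  apply/asboolP; exists [::] => //; split=> //; split=> // -[a].
  by rewrite big_ord0 => e; apply: x0; rewrite -[x]scale1r [X in X *: _]e scale0r.
have [|d /asboolP[s rs sd] dmax] := @ex_maxnP reg q (ex_intro _ 0%N reg0).
  by move=> d /asboolP[s /ub/ltnW + <-].
exists d; last by rewrite -sd; apply: ub.
by split=> [|t rt]; [exists s | apply: dmax; apply/asboolP; exists t].
Qed.

Fixpoint cosyz r Z C : Prop :=
  if r is r'.+1 then
    exists C0 Q (i : {linear C0 -> Q}) (q : {linear Q -> C}),
      [/\ fg_projective Q, ses i q, extends_along RR i & cosyz r' Z C0]
  else C = Z.

Lemma cosyz_fin_gen r Z C : fin_gen Z -> cosyz r Z C -> fin_gen C.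
Proof.
case: r => [|r] fZ; first by move=> ->.
by move=> [C0 [Q [i [q [fQ siq _ _]]]]]; have [] := fin_gen_ses nR siq fQ.1.
Qed.

Lemma cosyz_tfree r s Z C : cosyz r Z C -> tfree (r + s) Z <-> tfree s C.
Proof.
elim: r s C => [|r IH] s C; first by move=> ->.
move=> [C0 [Q [i [q [fQ siq ei cZ]]]]].
by rewrite addSnnS (IH _ _ cZ); apply: (tfree_step nR s fQ siq ei).
Qed.

End Converse.

Lemma cosyz_localize (R : comPzRingType) (p : prime_ideal R) r (Z C : lmodType R) :
  noetherian R -> fin_gen Z -> cosyz r Z C ->
  cosyz r (localize p Z : lmodType (loc_ring p)) (localize p C).
Proof.
move=> nR fZ; elim: r C => [|r IH] C; first by move=> ->.
move=> [C0 [Q [i [q [fQ siq ei cZ]]]]].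
have [j [t [ij qt sjt]]] := ses_localize_ex p siq.
exists (localize p C0), (localize p Q), j, t; split=> //.
- exact: fg_projective_localize.
- exact: extends_along_localize nR (cosyz_fin_gen nR fZ cZ) ij ei.
- exact: IH.
Qed.

Section TorsionlessCosyzygy.
Variable R : comPzRingType.
Implicit Types C K M N P Q W Y Z : lmodType R.
Local Notation RR := (R^o : lmodType R).
Hypothesis nR : noetherian R.

Lemma torsion_linear C Y (f : {linear C -> Y}) (c : C) :
  (forall h : dual C, dual_fun h c = 0) -> forall h : dual Y, dual_fun h (f c) = 0.
Proof. by move=> c0 h; rewrite -dual_map_linE c0. Qed.

Lemma nonunit_frac (p : prime_ideal R) (r : R) s :
  nonunit (lfrac (r : R^o) s : loc_ring p) -> p r.
Proof.
move=> nu; apply: contrapT => npr; apply: nu.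
have rD : r \in is_denom p by apply/asboolP.
exists (lfrac (dval s : R^o) (Sub r rD : denom p)).
rewrite -[LHS]/(loc_scale _ _) loc_scaleE; apply: frac_eq.
by rewrite dvalM dval1 /dval /= /GRing.scale /=; ring.
Qed.

Lemma cosyz_torsionless M n i Z C Y :
  fin_gen M -> fin_gen Z ->
  (forall (p : prime_ideal R) (d : nat), depth_eq (loc_ring p) d -> (d < n)%N ->
     finite_gorenstein_dim (localize p M : lmodType (loc_ring p))) ->
  syz n M Z -> (i <= n)%N -> cosyz i Z C -> linked i C Y ->
  (forall c : C, (forall h : dual C, dual_fun h c = 0) ->
     forall f : {linear C -> Y}, f c = 0) ->
  torsionless C.
Proof.
move=> fM fZ gdM sZ le_in cC [P [K [k [f [fP skf rK]]]]] C0 c c0.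
have [ik ef _] := skf.
have [jC jCE] := pair_ex (idfun : {linear C -> C}) (\0 : {linear C -> P}).
(* y is c seen in K: its image in C + P is (c, 0). *)
have /ef[y yE] := C0 c c0 (f \o jC).
apply: contrapT => cn0; have yn0 : y <> 0.
  by move=> y0; apply: cn0; move: yE; rewrite y0 linear0 jCE => -[<-].
have [p [r pE]] := associated_prime nR yn0.
have pK (u : denom p) : dval u *: (r *: y) <> 0.
  by move/pE; have /asboolP := valP u.
have one0 : lfrac (r *: y) (denom1 p) <> 0 :> localize p K.
  by move/frac_eq0 => [u /pK].
have socle (a : loc_ring p) : nonunit a ->
    a *: (lfrac (r *: y) (denom1 p) : localize p K) = 0.
  elim/fracW: a => b s /nonunit_frac/pE e.
  by rewrite fracZ [b *: _]e frac0.
have nA := noetherian_localize (p := p) nR; have rKp := resolvable_localize p rK.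
have [d dA di] := depth_lt nA rKp one0 socle.
have gd := gdM p d dA (leq_trans di le_in).
have tZ := finite_gorenstein_dim_tfree nA rKp one0 socle le_in
  (fin_gen_localize p fM) gd (syz_localize p sZ).
have tC : torsionless (localize p C : lmodType (loc_ring p)).
  have := tZ (i + 1)%N.
  by move/(cosyz_tfree nA 1 (cosyz_localize p nR fZ cC)).
(* The torsion element r c dies in C_p; a denominator killing it kills r y too, against the choice
   of p. *)
have /frac_eq0[u uE] : lfrac (r *: c) (denom1 p) = 0 :> localize p C.
  apply: (torsion_localize nR (cosyz_fin_gen nR fZ cC) _ tC) => h.
  by rewrite /dual_fun linearZ /= [X in _ *: X]c0 scaler0.
apply: (pK u); apply: (inj0 ik); rewrite !linearZ /= yE jCE.
by apply: injective_projections; rewrite /= ?uE ?scaler0.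
Qed.

Lemma linked_cosyz_ex M n Z W (g : {linear M -> W}) :
  fin_gen M -> fin_gen Z ->
  (forall (p : prime_ideal R) (d : nat), depth_eq (loc_ring p) d -> (d < n)%N ->
     finite_gorenstein_dim (localize p M : lmodType (loc_ring p))) ->
  syz n M Z -> injective g -> proj_dim_le W n ->
  forall i, (i <= n)%N -> exists C Y,
    [/\ cosyz i Z C, linked i C Y, syz (n - i) M Y, Ext_zero i C RR & torsionless C].
Proof.
move=> fM fZ gdM sZ ig /proj_dim_leP[L0 [W' [j [q [fL sjq rW']]]]].
have tl i C Y : (i <= n)%N -> cosyz i Z C -> linked i C Y -> syz (n - i) M Y ->
    Ext_zero i C RR -> torsionless C.
  move=> le_in cC lCY sY eC.
  apply: (cosyz_torsionless fM fZ gdM sZ le_in cC lCY) => c c0 f.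
  (* For i < n, Y is itself a syzygy and lies in a projective, where torsion dies. *)
  case E : (n - i)%N sY => [|m] /=; last first.
    move=> [Y' [P [k [r [fP [ik _ _] _]]]]]; apply: (inj0 ik).
    exact: (projective_torsionless fP) (torsion_linear (k \o f) c0).
  move=> YM; move: f; rewrite YM => f; apply: (inj0 ig).
  have ni : n = i by apply/eqP; rewrite eqn_leq le_in andbT -subn_eq0 E.
  (* For i = n, the n degrees of Ext gained along the cosyzygies are just enough, as W' has
     projective dimension less than n; so C -> M -> W lifts to the projective over W. *)
  have eW' : Ext_zero 1 C W'.
    apply: (Ext_zero_resolvable nR (cosyz_fin_gen nR fZ cC) rW').
    by rewrite addn0 ni.
  have [w wE] := Ext1_zero_lift (g \o f) sjq (Ext_zero1 eW').
  rewrite -[g (f c)]wE (_ : w c = 0) ?linear0 //.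
  exact: (projective_torsionless fL) (torsion_linear w c0).
elim=> [_|i IH le_in].
  have lZ := linked_refl Z; exists Z, Z; rewrite subn0.
  by split=> //; apply: (tl 0%N Z Z) => //; rewrite subn0.
have [C [Y [cC lCY sY eC tC]]] := IH (ltnW le_in).
have fC := cosyz_fin_gen nR fZ cC.
have [Q [C' [k [r [fQ skr ek]]]]] := torsionless_embed nR fC tC.
move: sY; rewrite -(subnSK le_in) => -[Y' [P [k' [r' [fP skr' sY']]]]].
have lCY' := linked_step fQ skr ek fP skr' lCY.
have eC' := Ext_zero_cover nR fQ skr ek eC.
have cC' : cosyz i.+1 Z C' by exists C, Q, k, r.
by exists C', Y'; split=> //; apply: (tl i.+1 C' Y').
Qed.

End TorsionlessCosyzygy.

Theorem theorem1p3 (R : comPzRingType) (Rnoeth : noetherian R)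
    (M : lmodType R) (Mfg : fin_gen M) (n : nat)
    (N : lmodType R) (NM : is_syzygy M n N) :
  (torsionfree n.+1 N ->
     exists2 W : lmodType R, fin_gen W /\ proj_dim_le W n &
       exists f : {linear M -> W}, injective f) /\
  ((forall (p : prime_ideal R) (d : nat),
      depth_eq (loc_ring p) d -> (d < n)%N ->
      finite_gorenstein_dim (localize p M : lmodType (loc_ring p))) ->
   (exists2 W : lmodType R, fin_gen W /\ proj_dim_le W n &
      exists f : {linear M -> W}, injective f) ->
   torsionfree n.+1 N).
Proof.
have sN := is_syzygy_syz NM.
have fN : fin_gen N.
  case: n {NM} sN => [-> //|n [N' [P [i [p [fP sip _]]]]]].
  by have [] := fin_gen_ses Rnoeth sip fP.1.
split=> [/(torsionfreeP Rnoeth n.+1 fN) tN|gdM [W [fW pW] [g ig]]].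
  exact: embed_of_syzygy_tfree sN fN tN.
apply/(torsionfreeP Rnoeth n.+1 fN).
have [C [Y [cC _ _ _ tC]]] :=
  linked_cosyz_ex Rnoeth Mfg fN gdM sN ig pW (leqnn n).
(* Order 1 for the n-th cosyzygy is order n + 1 for N. *)
by rewrite -addn1; apply/(cosyz_tfree Rnoeth 1 cC).
Qed.
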